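(* Let $m,n,k$ be integers with $1\le k\le \min(m,n)$. Let $M$ be an $m\times n$ matrix in which each entry is either the constant $0$ or an exponential random variable with an arbitrary positive (finite) rate, all the random entries being independent. Let $Z$ be the set of positions of the zero entries, and assume that $Z$ contains $k-1$ zeros in independent position (so that $\mathrm{E}[\min_{k-1}(M)]=0$). Let $Q_{k,Z}$ be the poset of critical rectangles, let $I$ denote the rate of a set of positions, and let $f$ be the element of the incidence algebra of $Q_{k,Z}$ given by $f(R,R')=I(R\cap R')$ for $R\le R'$. Then $$\mathrm{E}[{\min}_k(M)]=\sum_{R\le R'} f^{-1}(R,R'),$$ where the sum is over all intervals in $Q_{k,Z}$ (i.e. over all pairs $R\le R'$ in $Q_{k,Z}$, including $R=R'$) and $f^{-1}$ is the inverse of $f$ in the incidence algebra. Equivalently, $$\mathrm{E}[{\min}_k(M)]=\sum_{R_1<R_2<\dots<R_s}(-1)^{s-1}\,\frac{I(R_1\cap R_2)\,I(R_2\cap R_3)\cdots I(R_{s-1}\cap R_s)}{I(R_1)\,I(R_2)\cdots I(R_s)},$$ where the sum is taken over all non-empty chains in $Q_{k,Z}$.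
   Context: A $k$-assignment in an $m\times n$ matrix is a collection of $k$ entries (positions) no two of which are in the same row or the same column; its value is the sum of its entries. $\min_k(M)$ denotes the minimum value of a $k$-assignment in $M$; it is a random variable when the entries of $M$ are. Zeros are in independent position if no two of them are in the same row or the same column. A random variable $X$ is exponential with rate $a>0$ if $P(X>t)=e^{-at}$ for $t\ge 0$. Let $\alpha$ be a set of rows and columns of the matrix. It covers $Z$ if every position in $Z$ lies in a row of $\alpha$ or in a column of $\alpha$. A $(k-1)$-cover is a cover of $Z$ consisting of $k-1$ rows and columns in total. The rectangle $R(\alpha)$ is the set of positions of the matrix lying neither in a row of $\alpha$ nor in a column of $\alpha$. If $\alpha$ is a $(k-1)$-cover of $Z$, then $R(\alpha)$ is called critical; $Q_{k,Z}$ is the set of all critical rectangles. It is partially ordered by: $R(\alpha)\le R(\beta)$ if the set of columns in $\alpha$ is a subset of the set of columns in $\beta$ and the set of rows in $\alpha$ is a superset of the set of rows in $\beta$. For a set $R$ of positions containing no position of $Z$ (such as a critical rectangle or an intersection of critical rectangles), its rate $I(R)$ is the sum of the rates of the entries of $M$ at the positions in $R$ (so $I(\emptyset)=0$). The incidence algebra of a finite poset is the algebra of real-valued functions $f(x,y)$ defined on pairs $x\le y$, with product $(fg)(x,y)=\sum_{x\le z\le y}f(x,z)g(z,y)$; its identity is $\delta(x,y)=1$ if $x=y$ and $0$ otherwise. Here $f$ is invertible since $f(R,R)=I(R)>0$ for every critical rectangle $R$. A chain $R_1<\dots<R_s$ has $s\ge 1$; for $s=1$ the numerator in the formula is the empty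 product $1$. Empty sums are $0$. *)

(* Defs.v *)
From HB Require Import structures.
From mathcomp Require Import all_boot all_order all_algebra.
From mathcomp Require Import all_classical all_reals all_analysis.

Set Implicit Arguments.
Unset Strict Implicit.
Unset Printing Implicit Defensive.

Import Order.TTheory GRing.Theory Num.Theory.

Local Open Scope ring_scope.

(** * Assignments *)

Definition in_independent_position (m n : nat) (A : {set 'I_m * 'I_n}) : bool :=
  [forall p in A, forall q in A,
     (p != q) ==> (p.1 != q.1) && (p.2 != q.2)].

Definition is_assignment (k : nat) (m n : nat) (A : {set 'I_m * 'I_n}) : bool :=
  in_independent_position A && (#|A| == k).

Definition assignment_value (R : realType) (m n : nat) (N : 'M[R]_(m, n))
    (A : {set 'I_m * 'I_n}) : R :=
  \sum_(p in A) N p.1 p.2.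

(* The infimum of a finite set of values, nonempty when k <= min(m, n): see
   [min_assignment_is_min]. *)
Definition min_assignment (R : realType) (k m n : nat) (N : 'M[R]_(m, n)) : R :=
  inf [set assignment_value N A | A in [set A | is_assignment k A]]%classic.

Lemma exists_assignment (k m n : nat) : (k <= minn m n)%N ->
  exists A : {set 'I_m * 'I_n}, is_assignment k A.
Proof.
rewrite leq_min => /andP[km kn].
pose g (i : 'I_k) : 'I_m * 'I_n := (widen_ord km i, widen_ord kn i).
have injg : injective g by move=> i j [] /ord_inj.
exists [set g i | i : 'I_k]; apply/andP; split; last first.
  by rewrite card_imset// card_ord.
apply/forall_inP => p /imsetP[i _ ->]; apply/forall_inP => q /imsetP[j _ ->].
apply/implyP => gij; have ij : i != j by apply: contra_neq gij => ->.
apply/andP; split; apply: contra_neq ij => /(congr1 val)/= h;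
  exact: val_inj.
Qed.

Lemma min_assignment_is_min (R : realType) (k m n : nat) (N : 'M[R]_(m, n)) :
  (k <= minn m n)%N ->
  (exists2 A, is_assignment k A & min_assignment k N = assignment_value N A) /\
  (forall A, is_assignment k A -> min_assignment k N <= assignment_value N A).
Proof.
move=> /exists_assignment[A0 kA0].
have [A kA minA] := Order.TotalTheory.arg_minP (assignment_value N) kA0.
have -> : min_assignment k N = assignment_value N A.
  apply/le_anti/andP; split.
    apply: ge_inf; last by exists A.
    by exists (assignment_value N A) => _ [B /= kB <-]; exact: minA.
  apply: lb_le_inf; first by exists (assignment_value N A), A.
  by move=> _ [B /= kB <-]; exact: minA.
by split=> //; exists A.
Qed.

(** * Covers and critical rectangles *)

(* A set of rows and columns is a pair [(rows, columns)]. *)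
Definition covers (m n : nat) (Z : {set 'I_m * 'I_n})
    (a : {set 'I_m} * {set 'I_n}) : bool :=
  [forall p in Z, (p.1 \in a.1) || (p.2 \in a.2)].

Definition is_cover (l m n : nat) (Z : {set 'I_m * 'I_n})
    (a : {set 'I_m} * {set 'I_n}) : bool :=
  covers Z a && (#|a.1| + #|a.2| == l)%N.

Definition rectangle (m n : nat) (a : {set 'I_m} * {set 'I_n}) :
    {set 'I_m * 'I_n} :=
  [set p | (p.1 \notin a.1) && (p.2 \notin a.2)].

(* The poset $Q_{k,Z}$. A critical rectangle is given by the (k-1)-cover that
   defines it; by [critical_rect_inj] this is the same thing as the set of
   positions itself as soon as 1 <= k <= min(m, n). *)
Record critical (m n k : nat) (Z : {set 'I_m * 'I_n}) := Critical {
  cover_of : {set 'I_m} * {set 'I_n};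
  cover_ofP : is_cover k.-1 Z cover_of }.

HB.instance Definition _ m n k (Z : {set 'I_m * 'I_n}) :=
  [isSub for @cover_of m n k Z].
HB.instance Definition _ m n k (Z : {set 'I_m * 'I_n}) :=
  [Countable of critical k Z by <:].
HB.instance Definition _ m n k (Z : {set 'I_m * 'I_n}) :=
  [Finite of critical k Z by <:].

Definition rect (m n k : nat) (Z : {set 'I_m * 'I_n}) (x : critical k Z) :
    {set 'I_m * 'I_n} :=
  rectangle (cover_of x).

Lemma rectangle_inj (l m n : nat) (a b : {set 'I_m} * {set 'I_n}) :
  (l < minn m n)%N ->
  (#|a.1| + #|a.2| = l)%N -> (#|b.1| + #|b.2| = l)%N ->
  rectangle a = rectangle b -> a = b.
Proof.
rewrite leq_min => /andP[lm ln] al bl eab.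
have ex q (B : {set 'I_q}) : (#|B| <= l)%N -> (l < q)%N -> exists i, i \notin B.
  move=> Bl lq; apply/existsP; apply: contraLR lq; rewrite negb_exists -leqNgt.
  move=> /forallP h; apply: leq_trans Bl.
  rewrite -[X in (X <= _)%N]card_ord; apply/subset_leq_card/fintype.subsetP => i _.
  by have := h i; rewrite negbK.
have [ra rb] : (#|a.1| <= l /\ #|b.1| <= l)%N by rewrite -{1}al -bl !leq_addr.
have [ca cb] : (#|a.2| <= l /\ #|b.2| <= l)%N by rewrite -{1}al -bl !leq_addl.
have [i ia] := ex _ _ ra lm; have [j ja] := ex _ _ ca ln.
have mem p : (p.1 \notin a.1) && (p.2 \notin a.2) =
             (p.1 \notin b.1) && (p.2 \notin b.2).
  by have := congr1 (fun E : {set _} => p \in E) eab; rewrite !inE.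
have := mem (i, j); rewrite /= ia ja /= => /esym/andP[ib jb].
rewrite [a]surjective_pairing [b]surjective_pairing.
congr pair; apply/setP => h; apply: negb_inj.
- by have := mem (h, j); rewrite /= ja jb !andbT.
- by have := mem (i, h); rewrite /= ia ib.
Qed.

Lemma critical_rect_inj (m n k : nat) (Z : {set 'I_m * 'I_n}) :
  (0 < k)%N -> (k <= minn m n)%N -> injective (@rect m n k Z).
Proof.
move=> k0 kmn x y exy; apply: val_inj => /=.
have /andP[_ /eqP cx] := cover_ofP x; have /andP[_ /eqP cy] := cover_ofP y.
by apply: rectangle_inj cx cy exy; rewrite prednK.
Qed.

Section critical_order.
Context (m n k : nat) (Z : {set 'I_m * 'I_n}).
Implicit Types x y : critical k Z.

Definition critical_le x y : bool :=
  ((cover_of x).2 \subset (cover_of y).2) &&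
  ((cover_of y).1 \subset (cover_of x).1).

Let le_refl : reflexive critical_le.
Proof. by move=> x; rewrite /critical_le !subxx. Qed.

Let le_anti : antisymmetric critical_le.
Proof.
move=> x y /andP[/andP[c1 r1] /andP[c2 r2]]; apply: val_inj => /=.
rewrite [cover_of x]surjective_pairing [cover_of y]surjective_pairing.
by congr pair; apply/eqP; rewrite finset.eqEsubset ?r1 ?r2 ?c1 ?c2.
Qed.

Let le_trans : transitive critical_le.
Proof.
move=> y x z /andP[c1 r1] /andP[c2 r2]; apply/andP; split.
- exact: fintype.subset_trans c1 c2.
- exact: fintype.subset_trans r2 r1.
Qed.

Fact critical_display : Order.disp_t. Proof. exact: Order.Disp tt tt. Qed.

HB.instance Definition _ := Order.Le_isPOrder.Build critical_display
  (critical k Z) le_refl le_anti le_trans.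

End critical_order.

(** * The incidence algebra of a finite poset *)

Definition poset_interval (d : Order.disp_t) (P : finPOrderType d) : Type :=
  {p : P * P | (p.1 <= p.2)%O}.

HB.instance Definition _ d (P : finPOrderType d) :=
  Finite.on (poset_interval P).

(* An alias of [{ffun _}], because the latter already carries the pointwise
   product. *)
Definition incidence (R : pzRingType) (d : Order.disp_t) (P : finPOrderType d) :
    Type :=
  {ffun poset_interval P -> R}.

Section incidence_algebra.
Context (R : pzRingType) (d : Order.disp_t) (P : finPOrderType d).
Local Notation incidence := (incidence R P).
Implicit Types f g h : incidence.

HB.instance Definition _ := GRing.Zmodule.on incidence.

(* The value at (x, y), extended by 0 to the pairs that are not intervals. *)
Definition incidence_val f (x y : P) : R :=
  if insub (x, y) is Some p then f p else 0.

Definition mk_incidence (F : P -> P -> R) : incidence :=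
  [ffun p : poset_interval P => F (val p).1 (val p).2].

Definition incidence_one : incidence :=
  mk_incidence (fun x y => (x == y)%:R).

Definition incidence_mul f g : incidence :=
  mk_incidence (fun x y =>
    \sum_(z : P | (x <= z <= y)%O) incidence_val f x z * incidence_val g z y).

Lemma mk_incidenceE F x y :
  incidence_val (mk_incidence F) x y = if (x <= y)%O then F x y else 0.
Proof.
rewrite /incidence_val; case: insubP => [p /= -> pE|/= /negbTE ->//].
by rewrite ffunE/= pE.
Qed.

Lemma incidence_val_gt f x y : ~~ (x <= y)%O -> incidence_val f x y = 0.
Proof. by move=> xy; rewrite /incidence_val insubN. Qed.

Lemma incidence_valP f g :
  (forall x y, (x <= y)%O -> incidence_val f x y = incidence_val g x y) ->
  f = g.
Proof.
move=> fg; apply/ffunP => p; have := fg (val p).1 (val p).2 (valP p).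
by rewrite /incidence_val -surjective_pairing valK.
Qed.

Lemma incidence_valD f g x y :
  incidence_val (f + g) x y = incidence_val f x y + incidence_val g x y.
Proof.
by rewrite /incidence_val; case: insubP => [p _ _|_]; rewrite ?ffunE ?addr0.
Qed.

Lemma incidence_mulE f g x y : incidence_val (incidence_mul f g) x y =
  \sum_z incidence_val f x z * incidence_val g z y.
Proof.
have zE z : ~~ (x <= z <= y)%O -> incidence_val f x z * incidence_val g z y = 0.
  by rewrite negb_and => /orP[] h; rewrite (incidence_val_gt _ h) ?mul0r ?mulr0.
rewrite mk_incidenceE [RHS](bigID (fun z => (x <= z <= y)%O))/=.
rewrite [X in _ + X]big1 ?addr0//; case: ifPn => // xy; rewrite big_pred0// => z.
by apply: contraNF xy => /andP[]; exact: le_trans.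
Qed.

Lemma incidence_oneE x y : incidence_val incidence_one x y = (x == y)%:R.
Proof.
by rewrite mk_incidenceE; case: ifPn => // xy; case: eqP xy => // ->; rewrite lexx.
Qed.

Let mulA : associative incidence_mul.
Proof.
move=> f g h; apply: incidence_valP => x y _; rewrite !incidence_mulE.
under eq_bigr do rewrite incidence_mulE big_distrr/=.
under [RHS]eq_bigr do rewrite incidence_mulE big_distrl/=.
rewrite exchange_big/=; apply: eq_bigr => z _; apply: eq_bigr => t _.
by rewrite mulrA.
Qed.

Let mul1 : left_id incidence_one incidence_mul.
Proof.
move=> f; apply: incidence_valP => x y _; rewrite incidence_mulE (bigD1 x)//=.
rewrite incidence_oneE eqxx mul1r big1 ?addr0// => z zx.
by rewrite incidence_oneE eq_sym (negbTE zx) mul0r.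
Qed.

Let mulr1 : right_id incidence_one incidence_mul.
Proof.
move=> f; apply: incidence_valP => x y _; rewrite incidence_mulE (bigD1 y)//=.
rewrite incidence_oneE eqxx mulr1 big1 ?addr0// => z zy.
by rewrite incidence_oneE (negbTE zy) mulr0.
Qed.

Let mulDl : left_distributive incidence_mul +%R.
Proof.
move=> f g h; apply: incidence_valP => x y _.
rewrite incidence_valD !incidence_mulE -big_split/=; apply: eq_bigr => z _.
by rewrite incidence_valD mulrDl.
Qed.

Let mulDr : right_distributive incidence_mul +%R.
Proof.
move=> f g h; apply: incidence_valP => x y _.
rewrite incidence_valD !incidence_mulE -big_split/=; apply: eq_bigr => z _.
by rewrite incidence_valD mulrDr.
Qed.

HB.instance Definition _ := GRing.Zmodule_isPzRing.Build incidence
  mulA mul1 mulr1 mulDl mulDr.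

End incidence_algebra.

(** * Rates *)

Definition rate_of (R : realType) (m n : nat) (a : 'M[R]_(m, n))
    (A : {set 'I_m * 'I_n}) : R :=
  \sum_(p in A) a p.1 p.2.

Definition rate_incidence (R : realType) (m n k : nat) (a : 'M[R]_(m, n))
    (Z : {set 'I_m * 'I_n}) : incidence R (critical k Z) :=
  mk_incidence (fun x y => rate_of a (rect x :&: rect y)).

(* The term of the chain x_0 < ... < x_s (a chain with s + 1 elements). *)
Definition chain_term (R : realType) (m n k : nat) (a : 'M[R]_(m, n))
    (Z : {set 'I_m * 'I_n}) (s : nat) (x : s.+1.-tuple (critical k Z)) : R :=
  (-1) ^+ s *
  (\prod_(i < s) rate_of a (rect (tnth x (widen_ord (leqnSn s) i))
                            :&: rect (tnth x (lift ord0 i)))) /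
  \prod_(i < s.+1) rate_of a (rect (tnth x i)).

(* The sum over all nonempty chains: a strictly increasing sequence has at most
   [#|critical k Z|] elements. *)
Definition chain_sum (R : realType) (m n k : nat) (a : 'M[R]_(m, n))
    (Z : {set 'I_m * 'I_n}) : R :=
  \sum_(s < #|{: critical k Z}|)
    \sum_(x : s.+1.-tuple (critical k Z) | sorted <%O x) chain_term a x.

(** * Random matrices *)

Section random.
Context (R : realType) (d : measure_display) (T : measurableType d)
  (P : probability T R).
Local Open Scope classical_set_scope.
Local Open Scope ereal_scope.

Definition exponential_with_rate (a : R) (X : {RV P >-> R}) : Prop :=
  forall t : R, (0 <= t)%R -> P [set w | (t < X w)%R] = (expR (- a * t))%:E.

Definition mutually_independent (I : finType) (A : {set I})
    (X : I -> {RV P >-> R}) : Prop :=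
  forall (J : {set I}) (B : I -> set R), J \subset A ->
    (forall i, measurable (B i)) ->
    P (\bigcap_(i in [set` J]) (X i @^-1` B i)) =
    \prod_(i in J) P (X i @^-1` B i).

Definition outcome (m n : nat) (M : 'M[{RV P >-> R}]_(m, n)) (w : T) :
    'M[R]_(m, n) :=
  map_mx (fun X : {RV P >-> R} => X w) M.

End random.

(* Main.v *)
(* The k-1 independent zeros make min_k(M) a first-passage time. Let b be the
   least critical rectangle, I its rate, and x the smallest entry of M in it.
   Subtracting x from the entries in b lowers min_k by exactly x, and by lack of
   memory the new matrix, given that the minimum was attained at p, is again of
   the same kind with p added to Z. Hence
     E(Z) = 1 / I + \sum_(p in b) (a_p / I) E(Z + p),
   the recursion for the expected lifetime of a Markov chain on Q_{k,Z} started
   at b. Let v(y) be the expected time this chain spends in y. When it leaves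
   the down-set of z from y it does so at rate I(y ∩ z), and it leaves almost
   surely, so v f = (1, ..., 1) and E = \sum_y v(y) is the sum of the entries of
   the inverse of f.

   The lack of memory only needs the joint tails P(X_p > t_p for all p), by
   cutting the time axis into slices of length h and letting h tend to 0. *)
Require Import Defs.
From HB Require Import structures.
From mathcomp Require Import all_boot all_order all_algebra.
From mathcomp Require Import all_classical all_reals all_analysis.
From mathcomp Require Import measurable_realfun.
From mathcomp Require Import zify lra ring.

Set Implicit Arguments.
Unset Strict Implicit.
Unset Printing Implicit Defensive.

Import Order.TTheory GRing.Theory Num.Theory.

Local Open Scope ring_scope.

(** * König's theorem *)

Section bipartite.
Context (m n : nat).
Implicit Types (A B G Z : {set 'I_m * 'I_n}) (a b : {set 'I_m} * {set 'I_n}).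

Definition cover_size a : nat := (#|a.1| + #|a.2|)%N.

Lemma independentP A :
  reflect ({in A &, injective fst} /\ {in A &, injective snd})
    (in_independent_position A).
Proof.
apply: (iffP forall_inP) => [h|[h1 h2] p pA].
  split=> p q pA qA pq; apply/eqP; move/forall_inP: (h p pA) => /(_ q qA);
    by rewrite pq eqxx ?andbF/=; case: (p == q).
apply/forall_inP => q qA; apply/implyP => pq.
by apply/andP; split; apply: contra_neq pq; [exact: h1|exact: h2].
Qed.

Lemma independentS A B :
  A \subset B -> in_independent_position B -> in_independent_position A.
Proof.
move=> /fintype.subsetP AB /independentP[h1 h2]; apply/independentP.
by split=> p q /AB pB /AB qB; [exact: h1|exact: h2].
Qed.

Lemma coversP G a :
  reflect {in G, forall p, (p.1 \in a.1) || (p.2 \in a.2)} (covers G a).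
Proof. exact: forall_inP. Qed.

Lemma coversS A B a : A \subset B -> covers B a -> covers A a.
Proof. by move=> /fintype.subsetP AB /coversP h; apply/coversP => p /AB /h. Qed.

Lemma independent_cover A a :
  in_independent_position A -> covers A a -> (#|A| <= cover_size a)%N.
Proof.
move=> /independentP[h1 h2] /coversP cA.
rewrite -(cardsID [set p : 'I_m * 'I_n | p.1 \in a.1] A) leq_add//.
  rewrite -(@card_in_imset _ _ fst).
    by apply/subset_leq_card/fintype.subsetP => _ /imsetP[p + ->]; rewrite !inE => /andP[].
  by move=> p q; rewrite !inE => /andP[pA _] /andP[qA _]; exact: h1.
rewrite -(@card_in_imset _ _ snd).
  apply/subset_leq_card/fintype.subsetP => _ /imsetP[p + ->].
  by rewrite !inE => /andP[pa /cA]; rewrite (negbTE pa).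
by move=> p q; rewrite !inE => /andP[_ pA] /andP[_ qA]; exact: h2.
Qed.

(* Crossing the two covers gives two covers of [G] of total size at most
   [2 * l + 1]. *)
Lemma koenig_merge_row G l (x : 'I_m) (y z : 'I_n) :
  (forall a, covers G a -> (l.+1 <= cover_size a)%N) ->
  (x, y) \in G -> (x, z) \in G -> y != z ->
  (exists2 a, covers (G :\ (x, y)) a & (cover_size a <= l)%N) ->
  (exists2 a, covers (G :\ (x, z)) a & (cover_size a <= l)%N) -> False.
Proof.
move=> lG xyG xzG yz [[r1 c1] /coversP c1G s1] [[r2 c2] /coversP c2G s2].
have nG r c l' : (cover_size (r, c) <= l')%N -> (l' <= l)%N -> covers G (r, c) -> False.
  by move=> s l'l /lG; rewrite /cover_size/= in s *; lia.
(* If row [x] were in [r1], the cover of [G :\ (x, y)] would also cover [(x, y)], hence [G], with at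
   most [l] lines. *)
have xr1 : x \notin r1.
  apply/negP => xr1; apply: (nG _ _ _ s1 (leqnn _)); apply/coversP => p pG.
  have [->|pxy] := eqVneq p (x, y); first by rewrite /= xr1.
  by apply: c1G; rewrite !inE pxy.
have xr2 : x \notin r2.
  apply/negP => xr2; apply: (nG _ _ _ s2 (leqnn _)); apply/coversP => p pG.
  have [->|pxz] := eqVneq p (x, z); first by rewrite /= xr2.
  by apply: c2G; rewrite !inE pxz.
have zc1 : z \in c1.
  have := c1G (x, z); rewrite !inE /= xzG xpair_eqE eqxx/= (eq_sym z) yz (negbTE xr1).
  exact.
have yc2 : y \in c2.
  have := c2G (x, y); rewrite !inE /= xyG xpair_eqE eqxx/= yz (negbTE xr2).
  exact.
have h1 : covers G (r1 :&: r2, c1 :|: c2).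
  apply/coversP => p pG; rewrite !inE.
  have [->/=|pxy] := eqVneq p (x, y); first by rewrite yc2 !orbT.
  have [->/=|pxz] := eqVneq p (x, z); first by rewrite zc1 !orbT.
  have := c1G p; have := c2G p; rewrite !inE pxy pxz pG /= => /(_ isT) + /(_ isT).
  by case: (p.1 \in r1); case: (p.1 \in r2); case: (p.2 \in c1); case: (p.2 \in c2).
(* Row [x] lies in neither [r1] nor [r2] and is put back for the two deleted edges; it accounts for
   the 1 in [2 * l + 1]. *)
have h2 : covers G (x |: (r1 :|: r2), c1 :&: c2).
  apply/coversP => p pG; rewrite !inE.
  have [->/=|pxy] := eqVneq p (x, y); first by rewrite eqxx.
  have [->/=|pxz] := eqVneq p (x, z); first by rewrite eqxx.
  have := c1G p; have := c2G p; rewrite !inE pxy pxz pG /= => /(_ isT) + /(_ isT).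
  by rewrite orbA; case: (p.1 \in r1); case: (p.1 \in r2); rewrite ?orbT//= => -> ->; rewrite orbT.
have := lG _ h1; have := lG _ h2; rewrite /cover_size/= in s1 s2 *.
have := cardsUI r1 r2; have := cardsUI c1 c2; rewrite cardsU1 !inE (negbTE xr1) (negbTE xr2)/=.
lia.
Qed.

End bipartite.

Definition swap_set (m n : nat) (G : {set 'I_m * 'I_n}) : {set 'I_n * 'I_m} :=
  [set p | (p.2, p.1) \in G].

Lemma covers_swap (m n : nat) (G : {set 'I_m * 'I_n}) a :
  covers (swap_set G) a = covers G (a.2, a.1).
Proof.
apply/coversP/coversP => h [i j] /= ijG; first by have := h (j, i); rewrite inE orbC; apply.
by have := h (j, i); rewrite /= orbC; apply; move: ijG; rewrite inE.
Qed.

(** Induction on the size of [G]. If some edge can be deleted without creating a cover of size below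
    [l], delete it. Otherwise every edge is critical, and [koenig_merge_row], used for [G] and for
    its transpose, shows that no two edges share a row or a column, so [G] itself will do. It has at
    least [l] edges because the rows that it meets cover it. *)
Theorem koenig (m n : nat) (G : {set 'I_m * 'I_n}) l :
  (forall a, covers G a -> (l <= cover_size a)%N) ->
  exists2 A : {set 'I_m * 'I_n}, A \subset G &
    in_independent_position A /\ (l <= #|A|)%N.
Proof.
elim: {G}_.+1 {-2}G (ltnSn #|G|) => // N IH G; rewrite ltnS => GN lG.
have cG : (l <= #|G|)%N.
  have := lG ([set p.1 | p in G], finset.set0).
  rewrite /cover_size/= cards0 addn0 => h; apply: leq_trans (leq_imset_card _ _); apply: h.
  by apply/coversP => p pG /=; rewrite imset_f.
have [/existsP[e /andP[eG /forallP h]]|] :=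
  boolP [exists e in G, [forall a, covers (G :\ e) a ==> (l <= cover_size a)%N]].
  have [||A AG Al] := IH (G :\ e).
  - by have := cardsD1 e G; rewrite eG; lia.
  - by move=> a; exact/implyP.
  by exists A => //; apply: fintype.subset_trans AG _; exact: subsetDl.
rewrite negb_exists => /forallP h; exists G => //; split=> //.
have {}h e : e \in G -> exists2 a, covers (G :\ e) a & (cover_size a < l)%N.
  move=> eG; have := h e; rewrite eG/= => /forallPn[a].
  by rewrite negb_imply -ltnNge => /andP[]; exists a.
case: l {IH} lG cG h => [|l] lG cG h.
  by apply/independentP; split=> p q /h[].
apply/independentP; split=> -[x y] [x' z] xyG xzG /=.
  move=> xx'; rewrite -{}xx' in xzG *; have [->//|yz] := eqVneq y z.
  by case: (koenig_merge_row lG xyG xzG yz (h _ xyG) (h _ xzG)).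
move=> yz; rewrite -{}yz in xzG *; have [->//|xx'] := eqVneq x x'.
have lG' a : covers (swap_set G) a -> (l < cover_size a)%N.
  by rewrite covers_swap => /lG; rewrite /cover_size /= addnC.
have h' u : u \in G ->
    exists2 a, covers (swap_set G :\ (u.2, u.1)) a & (cover_size a <= l)%N.
  move=> /h[a aG al]; exists (a.2, a.1); last by move: al; rewrite /cover_size/= addnC.
  have -> : swap_set G :\ (u.2, u.1) = swap_set (G :\ u).
    apply/setP => -[i j]; case: (u) => u1 u2; rewrite !inE /= !xpair_eqE.
    by rewrite (andbC (i == _)).
  by rewrite covers_swap/= -surjective_pairing.
by case: (@koenig_merge_row _ _ (swap_set G) l y x x' lG' _ _ xx' (h' _ xyG) (h' _ xzG)); rewrite inE.
Qed.

Lemma subset_card (T : finType) (A : {set T}) l :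
  (l <= #|A|)%N -> exists2 B : {set T}, B \subset A & #|B| = l.
Proof.
move=> lA; exists [set x in take l (enum A)].
  by apply/fintype.subsetP => x; rewrite inE => /mem_take; rewrite mem_enum.
rewrite cardsE; have /card_uniqP -> : uniq (take l (enum A)) by rewrite take_uniq// enum_uniq.
by rewrite size_take -cardE; case: ltnP => // h; apply/eqP; rewrite eqn_leq h lA.
Qed.

(** * Subtracting the minimum of the least critical rectangle *)

(* [lia] needs help to recognize convertible cardinals. *)
Ltac card_lia :=
  repeat (let c := fresh "c" in set c := #|_|; clearbody c); lia.

Section step.
Context (R : realType) (m n k : nat) (Z A0 : {set 'I_m * 'I_n}).
Hypotheses (A0Z : A0 \subset Z) (A0k : is_assignment k.-1 A0).
Implicit Types (a b : {set 'I_m} * {set 'I_n}).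

Lemma is_coverE a : is_cover k.-1 Z a = covers Z a && (cover_size a == k.-1).
Proof. by []. Qed.

Lemma cover_size_ge a : covers Z a -> (k.-1 <= cover_size a)%N.
Proof.
move=> aZ; case/andP: A0k => iA0 /eqP <-.
by apply: independent_cover => //; exact: coversS aZ.
Qed.

(** The order [critical_le] on bare pairs: the type [critical k Z] changes whenever a zero is added
    to [Z], and pairs can be compared across these changes. *)
Definition cover_le a b := (a.2 \subset b.2) && (b.1 \subset a.1).

(** Crossing two covers gives a meet and a join that are again covers, of total size twice [k.-1].
    Neither can be smaller than [k.-1], so both have exactly this size. Hence a cover with the
    fewest columns lies below all others. *)
Lemma cover_min : (exists a, is_cover k.-1 Z a) ->
  exists2 a, is_cover k.-1 Z a & forall b, is_cover k.-1 Z b -> cover_le a b.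
Proof.
case=> a0 a0Z; have [a aZ amin] : exists2 a, is_cover k.-1 Z a &
    forall b, is_cover k.-1 Z b -> (#|a.2| <= #|b.2|)%N.
  by case: (arg_minnP (fun a => #|a.2|) a0Z) => a aZ amin; exists a.
exists a => // b bZ; move: (aZ) (bZ).
rewrite !is_coverE /cover_size => /andP[/coversP ca /eqP sa] /andP[/coversP cb /eqP sb].
have c1 : covers Z (a.1 :|: b.1, a.2 :&: b.2).
  apply/coversP => p pZ; rewrite !inE; have := ca _ pZ; have := cb _ pZ.
  by case: (p.1 \in a.1); case: (p.1 \in b.1); case: (p.2 \in a.2); case: (p.2 \in b.2).
have c2 : covers Z (a.1 :&: b.1, a.2 :|: b.2).
  apply/coversP => p pZ; rewrite !inE; have := ca _ pZ; have := cb _ pZ.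
  by case: (p.1 \in a.1); case: (p.1 \in b.1); case: (p.2 \in a.2); case: (p.2 \in b.2).
have := cover_size_ge c1; have := cover_size_ge c2; rewrite /cover_size/= => s2 s1.
have := cardsUI a.1 b.1; have := cardsUI a.2 b.2 => u2 u1.
have s3 : (#|a.1 :|: b.1| + #|a.2 :&: b.2| = k.-1)%N.
  by move: u1 u2 s1 s2 sa sb; card_lia.
have := amin (a.1 :|: b.1, a.2 :&: b.2); rewrite is_coverE c1 /cover_size/= s3 eqxx => /(_ isT) h.
apply/andP; split.
  suff /eqP <- : a.2 :&: b.2 == a.2 by rewrite subsetIr.
  by rewrite eqEcard subsetIl h.
suff /eqP -> : a.1 == a.1 :|: b.1 by rewrite finset.subsetUr.
by rewrite eqEcard finset.subsetUl /=; move: s3 sa h; card_lia.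
Qed.

Lemma rectangle_disjoint a p : covers Z a -> p \in rectangle a -> p \notin Z.
Proof. by move=> /coversP h; rewrite inE -negb_or; apply: contra => /h. Qed.

Definition subtract_on (S : {set 'I_m * 'I_n}) (x : R) (N : 'M[R]_(m, n)) : 'M[R]_(m, n) :=
  \matrix_(i, j) (N i j - x *+ ((i, j) \in S)).

Lemma assignment_value_subtract S x N A :
  assignment_value N A = assignment_value (subtract_on S x N) A + x *+ #|A :&: S|.
Proof.
have -> : x *+ #|A :&: S| = \sum_(p in A) x *+ (p \in S).
  rewrite -sumr_const (eq_bigl (fun p => (p \in A) && (p \in S))) => [|p]; last by rewrite inE.
  by rewrite big_mkcondr/=; apply: eq_bigr => p _; case: ifP.
rewrite /assignment_value -big_split/=; apply: eq_bigr => -[i j] _.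
by rewrite mxE subrK.
Qed.

Hypotheses (k_gt0 : (0 < k)%N) (k_le : (k <= minn m n)%N).
Variable a : {set 'I_m} * {set 'I_n}.
Hypotheses (aZ : is_cover k.-1 Z a)
  (amin : forall b, is_cover k.-1 Z b -> cover_le a b).

Let aC : covers Z a. Proof. by case/andP: aZ. Qed.
Let aS : (#|a.1| + #|a.2| = k.-1)%N. Proof. by case/andP: aZ => _ /eqP. Qed.

(* König's theorem in the graph A ∪ A0 restricted to the columns outside the
   cover, with all the rows outside the cover merged into one. *)
Lemma cross_once A : is_assignment k A ->
  exists C : {set 'I_m * 'I_n}, [/\ in_independent_position C, C \subset A :|: A0,
    forall p, p \in C -> p.2 \notin a.2,
    (#|a.1| < #|C|)%N &
    {in C &, forall p q, p.1 \notin a.1 -> q.1 \notin a.1 -> p.1 = q.1} ].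
Proof.
move=> /andP[iA /eqP Ak]; case/andP: A0k => iA0 /eqP A0k'.
have [i0 i0a] : exists i, i \notin a.1.
  apply/existsP; rewrite -negb_forall; apply/negP => /forallP h.
  have : (m <= #|a.1|)%N.
    by rewrite -[X in (X <= _)%N]card_ord; apply/subset_leq_card/fintype.subsetP => i _; exact: h.
  by move: k_le; rewrite leq_min; lia.
pose out (B : {set 'I_m * 'I_n}) := [set p in B | p.2 \notin a.2].
have outE B : in_independent_position B -> (#|B| <= #|a.2| + #|out B|)%N.
  move=> iB; rewrite -(cardsID [set p : 'I_m * 'I_n | p.2 \in a.2] B) leq_add//.
    have := @independent_cover _ _ _ (finset.set0, a.2) (independentS (subsetIl _ _) iB).
    rewrite /cover_size/= cards0; apply.
    by apply/coversP => p; rewrite !inE => /andP[_ ->].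
  by apply/subset_leq_card/fintype.subsetP => p; rewrite !inE andbC.
pose f i := if i \in a.1 then i else i0.
pose F (p : 'I_m * 'I_n) := (f p.1, p.2).
(* If [i0] is in [b.1], the part of [A0] outside the columns [a.2] lies in the rows [a.1], has at
   least [k.-1 - #|a.2| = #|a.1|] elements and is covered by [b] without [i0]. If not, [b] covers
   the part of [A] outside these columns, which has at least [k - #|a.2| = #|a.1|.+1] elements. *)
have lG b : covers (F @: out (A :|: A0)) b -> (#|a.1|.+1 <= cover_size b)%N.
  move=> /coversP h.
  have hA p : p \in A :|: A0 -> p.2 \notin a.2 -> (f p.1 \in b.1) || (p.2 \in b.2).
    by move=> pA pa; apply: (h (F p)); rewrite imset_f// inE pA pa.
  have [i0b|i0b] := boolP (i0 \in b.1).
    have : covers (out A0) (b.1 :\ i0, b.2).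
      apply/coversP => p; rewrite !inE => /andP[pA0 pa].
      have /orP[pa1|] := coversP _ _ aC p (fintype.subsetP A0Z _ pA0); last by rewrite (negbTE pa).
      have := hA p; rewrite inE pA0 orbT pa /f pa1 => /(_ isT isT).
      by have -> // : p.1 != i0; apply: contraNneq i0a => <-.
    have iout : in_independent_position (out A0).
      by apply: independentS iA0; apply/fintype.subsetP => p; rewrite inE => /andP[].
    move=> /(independent_cover iout); rewrite /cover_size/= => h1.
    have := outE _ iA0; have := cardsD1 i0 b.1; rewrite i0b/= A0k' -aS.
    by move: h1; card_lia.
  have : covers (out A) b.
    apply/coversP => p; rewrite !inE => /andP[pA pa].
    have := hA p; rewrite inE pA pa => /(_ isT isT).
    by rewrite /f; case: ifP => // _; rewrite (negbTE i0b)/= => ->; rewrite orbT.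
  have iout : in_independent_position (out A).
    by apply: independentS iA; apply/fintype.subsetP => p; rewrite inE => /andP[].
  by move=> /(independent_cover iout); have := outE _ iA; rewrite Ak; move: aS k_gt0; card_lia.
have [C CG [/independentP[iC1 iC2] Ca]] := koenig lG.
(* A section of [F], which undoes the merging of rows; its default value is never reached on [C]. *)
pose g q := odflt q [pick p in out (A :|: A0) | F p == q].
have gP q : q \in C -> g q \in out (A :|: A0) /\ F (g q) = q.
  move=> qC; rewrite /g; case: pickP => [p /andP[pO /eqP]//|h].
  by have /imsetP[p pO qE] := fintype.subsetP CG _ qC; have := h p; rewrite pO qE eqxx.
have g1 q : q \in C -> f (g q).1 = q.1 by move=> /gP[_ /(congr1 fst)].
have g2 q : q \in C -> (g q).2 = q.2 by move=> /gP[_ /(congr1 snd)].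
have ginj : {in C &, injective g}.
  by move=> p q /gP[_ pE] /gP[_ qE] pq; rewrite -pE -qE pq.
exists (g @: C); split.
- apply/independentP; split=> _ _ /imsetP[p pC ->] /imsetP[q qC ->] h; congr g.
    by apply: iC1 => //; rewrite -g1// -(g1 q)// h.
  by apply: iC2 => //; rewrite -g2// -(g2 q).
- apply/fintype.subsetP => _ /imsetP[p pC ->].
  by have [] := gP _ pC; rewrite inE => /andP[].
- by move=> _ /imsetP[p pC ->]; have [] := gP _ pC; rewrite inE => /andP[].
- by rewrite card_in_imset.
move=> _ _ /imsetP[p pC ->] /imsetP[q qC ->] pa qa; congr (fst (g _)).
by apply: iC1 => //; rewrite -g1// -(g1 q)// /f (negbTE pa) (negbTE qa).
Qed.

(** By König's theorem it is enough that the zeros outside the rows [a.1] and [i0] have no cover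
    with fewer than [#|a.2|] lines. Adding the rows [a.1] and [i0] to such a cover would give a
    [k.-1]-cover of [Z] that contains a row outside [a.1], against the minimality of [a]. *)
Lemma zero_matching_avoiding i0 : i0 \notin a.1 ->
  exists2 D : {set 'I_m * 'I_n}, D \subset Z & [/\ in_independent_position D,
    (#|a.2| <= #|D|)%N & forall p, p \in D -> (p.1 != i0) && (p.1 \notin a.1)].
Proof.
move=> i0a; pose G := [set p in Z | (p.1 != i0) && (p.1 \notin a.1)].
have lG b : covers G b -> (#|a.2| <= cover_size b)%N.
  move=> /coversP h; rewrite leqNgt; apply/negP => hb.
  have : covers Z (i0 |: (b.1 :|: a.1), b.2).
    apply/coversP => p pZ; rewrite !inE; have := h p; rewrite inE pZ/=.
    by case: (p.1 == i0) => //=; case: (p.1 \in a.1); rewrite ?orbT//= orbF; exact.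
  move=> hc; have := cover_size_ge hc; have := hb; rewrite /cover_size/= => bs cs.
  have := cardsU1 i0 (b.1 :|: a.1); have := cardsU b.1 a.1 => c1 c2.
  have sz : (cover_size (i0 |: (b.1 :|: a.1), b.2) == k.-1)%N.
    rewrite eqn_leq cs andbT /cover_size/= -aS.
    by move: c1 c2 bs; case: (i0 \notin _); card_lia.
  have /amin/andP[_ /fintype.subsetP/(_ i0)/=] : is_cover k.-1 Z (i0 |: (b.1 :|: a.1), b.2).
    by rewrite is_coverE hc.
  by rewrite !inE eqxx (negbTE i0a) => /(_ isT).
have [D DG [iD Da]] := koenig lG; exists D.
  by apply: fintype.subset_trans DG _; apply/fintype.subsetP => p; rewrite inE => /andP[].
by split=> // p /(fintype.subsetP DG); rewrite inE => /andP[].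
Qed.

(** The set [C] of [cross_once] avoids the columns [a.2] and uses just one row outside [a.1], that
    of [p0]. Zeros in the columns [a.2], in rows other than this one and those of [a.1], complete it
    to at least [#|a.1| + 1 + #|a.2| = k] independent positions. Only the row of [p0] can meet the
    rectangle, and it does so at most once. *)
Lemma reroute A : is_assignment k A ->
  exists2 E : {set 'I_m * 'I_n}, is_assignment k E &
    E \subset A :|: Z /\ (#|E :&: rectangle a| <= 1)%N.
Proof.
move=> Ak; have [C [iC CA Ca2 Cs C1]] := cross_once Ak.
have [p0 p0C p0a] : exists2 p, p \in C & p.1 \notin a.1.
  apply/exists_inP; apply: contraT; rewrite negb_exists_in => /forall_inP h; exfalso.
  have := @independent_cover _ _ _ (a.1, finset.set0) iC; rewrite /cover_size/= cards0 addn0 leqNgt Cs.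
  have -> : covers C (a.1, finset.set0); last by move=> /(_ isT).
  by apply/coversP => p pC /=; move: (h _ pC); rewrite negbK => ->.
have [D DZ [iD Da D1]] := zero_matching_avoiding p0a.
have D2 p : p \in D -> p.2 \in a.2.
  by move=> pD; have /orP[|//] := coversP _ _ aC _ (fintype.subsetP DZ _ pD); have /andP[_ /negbTE ->] := D1 _ pD.
have CD0 : [disjoint C & D].
  by rewrite disjoint_subset; apply/fintype.subsetP => p pC; rewrite inE; apply: contra (Ca2 _ pC) => /D2.
have CD1 p q : p \in C -> q \in D -> p.1 != q.1.
  move=> pC qD; have /andP[q0 qa] := D1 _ qD; apply: contraNneq q0 => pq.
  by rewrite -pq (C1 _ _ pC p0C) // pq.
have CD2 p q : p \in C -> q \in D -> p.2 != q.2.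
  by move=> pC qD; apply: contraNneq (Ca2 _ pC) => ->; exact: D2.
have iCD : in_independent_position (C :|: D).
  move/independentP: iC => [iC1 iC2]; move/independentP: iD => [iD1 iD2].
  apply/independentP; split=> p q; rewrite !inE => /orP[pC|pD] /orP[qC|qD] h.
  - exact: iC1.
  - by have := CD1 _ _ pC qD; rewrite h eqxx.
  - by have := CD1 _ _ qC pD; rewrite h eqxx.
  - exact: iD1.
  - exact: iC2.
  - by have := CD2 _ _ pC qD; rewrite h eqxx.
  - by have := CD2 _ _ qC pD; rewrite h eqxx.
  - exact: iD2.
have [E ECD Ek] : exists2 E : {set 'I_m * 'I_n}, E \subset C :|: D & #|E| = k.
  apply: subset_card; have := cardsUI C D; have := disjoint_setI0 CD0 => ->.
  by rewrite cards0; move: Cs Da aS k_gt0; card_lia.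
exists E; first by apply/andP; split; [exact: independentS iCD|rewrite Ek].
split.
  apply: fintype.subset_trans ECD _; rewrite finset.subUset; apply/andP; split.
    apply: fintype.subset_trans CA _; rewrite finset.setUS//.
  by apply: fintype.subset_trans DZ _; exact: finset.subsetUr.
rewrite -(cards1 p0.1) -(@card_in_imset _ _ fst).
  apply/subset_leq_card/fintype.subsetP => _ /imsetP[p + ->].
  rewrite !inE => /andP[pE /andP[pa1 pa2]].
  have := fintype.subsetP ECD _ pE; rewrite inE => /orP[pC|/D2]; last by rewrite (negbTE pa2).
  by rewrite (C1 _ _ pC p0C).
move=> p q /setIP[/(fintype.subsetP ECD) pE _] /setIP[/(fintype.subsetP ECD) qE _].
by case/independentP: iCD => i1 _; exact: i1.
Qed.

(** Every [k]-assignment meets the rectangle, since the [k.-1] lines of [a] cannot cover it; so the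
    minimum drops by at least [x]. Conversely, [reroute] turns an optimal assignment of the new
    matrix into one that costs no more there and meets the rectangle at most once; so the minimum
    drops by at most [x]. *)
Lemma min_assignment_subtract (N : 'M[R]_(m, n)) (x : R) : 0 <= x ->
  (forall i j, (i, j) \in Z -> N i j = 0) ->
  (forall i j, 0 <= N i j) ->
  (forall i j, (i, j) \in rectangle a -> x <= N i j) ->
  min_assignment k N = x + min_assignment k (subtract_on (rectangle a) x N).
Proof.
move=> x0 NZ N0 Nx; set N' := subtract_on _ _ _.
have [[A Ak minA] lbA] := min_assignment_is_min N' k_le.
have [[B Bk minB] lbB] := min_assignment_is_min N k_le.
have N'0 i j : 0 <= N' i j.
  by rewrite mxE; case: (boolP (_ \in _)) => h; rewrite ?mulr1n ?subr0// subr_ge0 Nx.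
have N'Z i j : (i, j) \in Z -> N' i j = 0.
  move=> ijZ; rewrite mxE NZ//; case: (boolP (_ \in _)) => [ijR|_]; last by rewrite subr0.
  by have := rectangle_disjoint aC ijR; rewrite ijZ.
apply/le_anti/andP; split.
  have [E Ek [EA Ea]] := reroute Ak.
  apply: le_trans (lbB _ Ek) _; rewrite (assignment_value_subtract (rectangle a) x) addrC.
  apply: lerD; first by move: Ea; case: #|E :&: _| => [|[|]].
  rewrite minA /assignment_value (bigID (fun p => p \in A))/= [X in _ + X]big1 ?addr0.
    rewrite [leRHS](bigID (fun p => p \in E))/=.
    rewrite [leLHS](eq_bigl (fun p => (p \in A) && (p \in E))) ?lerDl ?sumr_ge0//.
    by move=> p; rewrite andbC.
  move=> [i j] /andP[/(fintype.subsetP EA)]; rewrite inE => /orP[->//|/N'Z ->//].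
rewrite minB (assignment_value_subtract (rectangle a) x) addrC lerD ?lbA//.
suff : (0 < #|B :&: rectangle a|)%N by case: #|_| => // l _; rewrite mulrS lerDl mulrn_wge0.
case/andP: Bk => iB /eqP Bk; rewrite lt0n cards_eq0; apply/negP => /eqP B0.
have := @independent_cover _ _ _ a iB; rewrite Bk /cover_size aS.
suff -> : covers B a by move=> /(_ isT); move: k_gt0; lia.
apply/coversP => p pB; rewrite -[_ || _]negbK negb_or; apply/negP => pa.
by have := finset.in_set0 p; rewrite -B0 !inE pB pa.
Qed.

(** The end of the recursion: if every cover needs at least [k] lines, König's theorem yields [k]
    independent zeros. *)
Lemma min_assignment_eq0 (N : 'M[R]_(m, n)) :
  ~ (exists b, is_cover k.-1 Z b) ->
  (forall i j, (i, j) \in Z -> N i j = 0) ->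
  (forall i j, 0 <= N i j) -> min_assignment k N = 0.
Proof.
move=> noQ NZ N0; have [[B Bk minB] lbB] := min_assignment_is_min N k_le.
have [b bZ|A AZ [iA Ak]] := @koenig _ _ Z k.
  rewrite leqNgt; apply/negP => bk; apply: noQ; exists b; rewrite is_coverE bZ/=.
  by rewrite eqn_leq cover_size_ge// andbT; move: bk k_gt0; case: (k).
have [E EA Ek] := subset_card Ak.
apply/le_anti/andP; split; last by rewrite minB sumr_ge0.
have /lbB/le_trans-> // : is_assignment k E.
  by apply/andP; split; [exact: independentS iA|rewrite Ek].
rewrite /assignment_value big1// => -[i j] /(fintype.subsetP EA)/(fintype.subsetP AZ).
exact: NZ.
Qed.

End step.

(** * Inverses in the incidence algebra *)

Section incidence_inverse.
Context (R : fieldType) (d : Order.disp_t) (P : finPOrderType d).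
Implicit Types (f g u : incidence R P).

Lemma incidence_sum_le (g : incidence R P) (c : P -> R) x :
  \sum_y incidence_val g x y * c y =
  \sum_(y | (x <= y)%O) incidence_val g x y * c y.
Proof.
rewrite (bigID (fun y => (x <= y)%O))/= [X in _ + X]big1 ?addr0// => y xy.
by rewrite incidence_val_gt ?mul0r.
Qed.

Lemma incidence_sumM f g (c : P -> R) x :
  \sum_y incidence_val (f * g) x y * c y =
  \sum_z incidence_val f x z * \sum_y incidence_val g z y * c y.
Proof.
under eq_bigr do rewrite incidence_mulE mulr_suml.
rewrite exchange_big/=; apply: eq_bigr => z _; rewrite mulr_sumr.
by apply: eq_bigr => y _; rewrite mulrA.
Qed.

(** A nonzero value of [u ^+ s] at [(x, y)] requires [s] strict steps from [x] up to [y]. Each step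
    adds to the number of elements strictly below, which is less than [#|P|] at [y]. *)
Lemma incidence_strict_nilpotent u : (forall x, incidence_val u x x = 0) ->
  u ^+ #|P| = 0.
Proof.
move=> u0; have step s x y : incidence_val (u ^+ s) x y != 0 ->
    (s + #|[pred z | (z < x)%O]| <= #|[pred z | (z < y)%O]|)%N.
  elim: s x => [|s IH] x.
    rewrite expr0 incidence_oneE; have [->//|] := eqVneq x y; by rewrite eqxx.
  rewrite exprS incidence_mulE => h.
  have [z zn0] : exists z, incidence_val u x z * incidence_val (u ^+ s) z y != 0.
    apply/existsP; apply: contra_neqT h => /existsPn h; rewrite big1// => z _.
    by apply/eqP; have := h z; rewrite negbK.
  move: zn0; rewrite mulf_eq0 negb_or => /andP[uxz /IH]; apply: leq_trans.
  rewrite addSnnS leq_add2l.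
  have xz : (x < z)%O.
    rewrite lt_neqAle; apply/andP; split.
      by apply: contraNneq uxz => ->; rewrite u0.
    by apply: contraNT uxz => xz; rewrite incidence_val_gt.
  apply: proper_card; apply/properP; split.
    by apply/fintype.subsetP => w; rewrite !inE => /lt_trans; apply.
  by exists x; rewrite !inE ?ltxx.
apply: incidence_valP => x y _; rewrite [RHS](_ : _ = 0); last first.
  by rewrite /incidence_val; case: insubP => // p _ _; rewrite ffunE.
apply/eqP; apply/negP => /negP/step; rewrite leqNgt => /negP; apply.
apply: leq_trans (leq_addr _ _); apply: proper_card; apply/properP.
by split; [exact: fintype.subset_predT|exists y; rewrite !inE ?ltxx].
Qed.

(** With [D] the diagonal of [f] and [E] its inverse, [f = D * (1 - u)] where [u] vanishes on the
    diagonal. Thus [u] is nilpotent and the finite geometric series [s] inverts [1 - u]. *)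
Lemma incidence_invertible f : (forall x, incidence_val f x x != 0) ->
  exists g, f * g = 1 /\ g * f = 1.
Proof.
move=> f0.
pose D := mk_incidence (fun x y : P => (x == y)%:R * incidence_val f x x).
pose E := mk_incidence (fun x y : P => (x == y)%:R * (incidence_val f x x)^-1).
have dE (c : P -> R) x y :
    incidence_val (mk_incidence (fun x y : P => (x == y)%:R * c x)) x y = (x == y)%:R * c x.
  by rewrite mk_incidenceE; case: ifPn => // xy; case: eqP xy => [->|_]; rewrite ?lexx ?mul0r.
have dM (c : P -> R) g x y :
    incidence_val (mk_incidence (fun x y : P => (x == y)%:R * c x) * g) x y = c x * incidence_val g x y.
  rewrite incidence_mulE (bigD1 x)//= dE eqxx mul1r big1 ?addr0// => z zx.
  by rewrite dE eq_sym (negbTE zx) !mul0r.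
have DE : D * E = 1.
  apply: incidence_valP => x y _; rewrite dM dE incidence_oneE.
  by case: eqP; rewrite ?mul1r ?mul0r ?mulr0// divff.
have ED : E * D = 1.
  apply: incidence_valP => x y _; rewrite dM dE incidence_oneE.
  by case: eqP; rewrite ?mul1r ?mul0r ?mulr0// mulVf.
pose u := 1 - E * f.
have uK : u ^+ #|P| = 0.
  apply: incidence_strict_nilpotent => x; apply: (addIr (incidence_val (E * f) x x)).
  by rewrite -incidence_valD subrK incidence_oneE dM add0r mulVf// eqxx.
pose s := \sum_(i < #|P|) u ^+ i.
have sE : (1 - u) * s = 1.
  rewrite /s mulrBl mul1r mulr_sumr.
  under [X in _ - X]eq_bigr do rewrite -exprS.
  rewrite -(big_mkord xpredT (fun i => u ^+ i)) -(big_mkord xpredT (fun i => u ^+ i.+1)).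
  rewrite -sumrB; apply: oppr_inj; rewrite -sumrN.
  under eq_bigr do rewrite opprB.
  by rewrite telescope_sumr// uK expr0 sub0r.
have us : u * s = s * u.
  by rewrite /s mulr_sumr mulr_suml; apply: eq_bigr => i _; rewrite -exprS exprSr.
have Es : s * (1 - u) = 1 by rewrite mulrBr mulr1 -us -[X in X - _]mul1r -mulrBl.
have uE : 1 - u = E * f by rewrite /u opprB addrC subrK.
exists (s * E); split; last by rewrite -mulrA -uE.
by rewrite -[f]mul1r -DE -(mulrA D) -uE -mulrA (mulrA (1 - u)) sE mul1r.
Qed.

End incidence_inverse.

(** * Chain sums *)

Section chains.
Context (R : realType) (m n k : nat) (a : 'M[R]_(m, n)) (Z : {set 'I_m * 'I_n}).
Local Notation Q := (critical k Z).
Local Notation F x y := (rate_of a (rect x :&: rect y)).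
Hypothesis F0 : forall x : Q, rate_of a (rect x) != 0.

Definition chain_sum_from (s : nat) (x : Q) : R :=
  \sum_(t : s.+1.-tuple Q | sorted <%O t && (thead t == x)) chain_term a t.

Lemma chain_sumE : chain_sum k a Z =
  \sum_x \sum_(s < #|{: Q}|) chain_sum_from s x.
Proof.
rewrite exchange_big/=; apply: eq_bigr => s _.
by rewrite (partition_big (@thead _ _) xpredT).
Qed.

Lemma chain_term_cons s (x : Q) (t : s.+1.-tuple Q) :
  chain_term a [tuple of x :: t] =
  - (F x (thead t) / rate_of a (rect x)) * chain_term a t.
Proof.
rewrite /chain_term exprS big_ord_recl [\prod_(i < s.+2) _]big_ord_recl.
rewrite (_ : tnth _ (lift ord0 ord0) = thead t) ?tnthS// (_ : tnth _ _ = x)//.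
under eq_bigr => i _.
  rewrite tnthS (_ : tnth _ (widen_ord _ _) = tnth t (widen_ord (leqnSn s) i)); last first.
    by rewrite -[RHS](tnthS x); congr tnth; exact: val_inj.
  over.
under [X in _ / (_ * X)]eq_bigr do rewrite tnthS.
rewrite invfM; ring.
Qed.

Lemma chain_sum_from0 x : chain_sum_from 0 x = (rate_of a (rect x))^-1.
Proof.
rewrite /chain_sum_from (big_pred1 [tuple x]) => [|t].
  by rewrite /chain_term expr0 big_ord0 mul1r mul1r big_ord1 tnth0.
case: t => -[//|y [|//]] /= h; rewrite /thead /= (tnth_nth x)/=.
by apply/eqP/eqP => [yx|/(congr1 val)[]//]; apply: val_inj; rewrite /= yx.
Qed.

(** Removing the least element [x] of a chain leaves a chain that starts at some [y > x]. *)
Lemma chain_sum_fromS s x : rate_of a (rect x) * chain_sum_from s.+1 x =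
  - \sum_(y | (x < y)%O) F x y * chain_sum_from s y.
Proof.
rewrite /chain_sum_from.
rewrite (reindex_onto (fun t : s.+1.-tuple Q => [tuple of x :: t])
  (fun t => [tuple of behead t])) /=; last first.
  by move=> t /andP[_ /eqP <-]; rewrite -tuple_eta.
under eq_bigl => t.
  rewrite theadE eqxx andbT (_ : _ == t); last by apply/eqP; exact: val_inj.
  rewrite andbT; over.
rewrite (partition_big (@thead _ _) (fun y => (x < y)%O))/=; last first.
  by move=> t; case/tupleP: t => y t /=; rewrite theadE => /andP[].
rewrite mulr_sumr -sumrN; apply: eq_bigr => y xy.
rewrite mulr_sumr mulr_sumr -sumrN.
apply: eq_big => [t|t /andP[_ /eqP ty]].
  case/tupleP: t => z t /=; rewrite theadE.
  by case: eqP => [->|]; rewrite ?andbF// xy.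
by rewrite chain_term_cons ty; field; exact: F0.
Qed.

(** The index [#|{: Q}|] stands for chains with one element more than the poset has; this closes the
    telescoping sum in [chain_sum_fromE]. *)
Lemma chain_sum_from_long x : chain_sum_from #|{: Q}| x = 0.
Proof.
rewrite /chain_sum_from big_pred0// => t; apply/negP => /andP[st _].
have ut : uniq t by apply: (sorted_uniq lt_trans ltxx st).
by have := max_card [in (t : seq Q)]; rewrite (card_uniqP ut) size_tuple ltnn.
Qed.

(** The chain sums by least element form the vector [w] with [f w = (1, ..., 1)]. By
    [chain_sum_fromS] the terms off the diagonal cancel those on it, except for the chain reduced to
    [x]. *)
Lemma chain_sum_fromE x :
  \sum_y incidence_val (rate_incidence k a Z) x y *
    \sum_(s < #|{: Q}|) chain_sum_from s y = 1.
Proof.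
rewrite incidence_sum_le (bigD1 x)//= mk_incidenceE lexx finset.setIid mulr_sumr.
have -> : \sum_(y | (x <= y)%O && (y != x))
    incidence_val (rate_incidence k a Z) x y * \sum_(s < #|{: Q}|) chain_sum_from s y =
    - \sum_(s < #|{: Q}|) rate_of a (rect x) * chain_sum_from s.+1 x.
  under eq_bigr do rewrite mulr_sumr.
  rewrite exchange_big -sumrN/=; apply: eq_bigr => s _; rewrite chain_sum_fromS opprK.
  apply: eq_big => y; first by rewrite lt_neqAle eq_sym andbC.
  by move=> /andP[xy _]; rewrite mk_incidenceE xy.
rewrite -sumrB; apply: oppr_inj; rewrite -sumrN.
under eq_bigr do rewrite opprB.
rewrite -(big_mkord xpredT (fun s => rate_of a (rect x) * chain_sum_from s.+1 x -
  rate_of a (rect x) * chain_sum_from s x)).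
rewrite (telescope_sumr (fun s => rate_of a (rect x) * chain_sum_from s x))//.
by rewrite chain_sum_from_long chain_sum_from0 mulr0 sub0r divff.
Qed.

(** Evaluate [v f w] in two ways, with [w] the vector of [chain_sum_fromE]: both [v f] and [f w] are
    the constant vector 1. *)
Lemma chain_sum_dual (v : Q -> R) :
  (forall z, \sum_(y | (y <= z)%O) v y * F y z = 1) ->
  chain_sum k a Z = \sum_y v y.
Proof.
move=> vF; rewrite chain_sumE.
transitivity (\sum_z (\sum_y v y * incidence_val (rate_incidence k a Z) y z) *
    \sum_(s < #|{: Q}|) chain_sum_from s z).
  apply: eq_bigr => z _; rewrite (bigID (fun y => (y <= z)%O))/=.
  rewrite [X in _ + X]big1 ?addr0; last first.
    by move=> y yz; rewrite incidence_val_gt ?mulr0.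
  under [X in _ = X * _]eq_bigr => y yz do rewrite mk_incidenceE yz.
  by rewrite vF mul1r.
under eq_bigr do rewrite mulr_suml.
rewrite exchange_big/=; apply: eq_bigr => y _.
under eq_bigr do rewrite -mulrA.
by rewrite -mulr_sumr chain_sum_fromE mulr1.
Qed.

(** The row sums of [g] are the entries of [g f w = w]. *)
Lemma chain_sum_inverse (g : incidence R Q) : g * rate_incidence k a Z = 1 ->
  chain_sum k a Z = \sum_x \sum_(y | (x <= y)%O) incidence_val g x y.
Proof.
move=> gf; rewrite chain_sumE; apply: eq_bigr => x _.
transitivity (\sum_y incidence_val (g * rate_incidence k a Z) x y *
    \sum_(s < #|{: Q}|) chain_sum_from s y).
  rewrite gf [RHS](bigD1 x)//= incidence_oneE eqxx mul1r [X in _ = _ + X]big1 ?addr0// => y yx.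
  by rewrite incidence_oneE eq_sym (negbTE yx) mul0r.
rewrite incidence_sumM; under eq_bigr do rewrite chain_sum_fromE.
by rewrite incidence_sum_le; apply: eq_bigr => y _; rewrite mulr1.
Qed.

End chains.

(** * Occupation times *)

Section occupation.
Context (R : realType) (m n k : nat) (a : 'M[R]_(m, n)).
Implicit Types (Z : {set 'I_m * 'I_n}) (b y z : {set 'I_m} * {set 'I_n}).

(* [v y] is the expected time spent in the state [y] by the Markov chain on the
   critical rectangles; this says that the chain almost surely leaves the
   down-set of [z], the exit rate from [y <= z] being that of [y :&: z]. *)
Definition is_occupation Z (v : {set 'I_m} * {set 'I_n} -> R) : Prop :=
  forall z, is_cover k.-1 Z z ->
    \sum_(y | is_cover k.-1 Z y && cover_le y z)
      v y * rate_of a (rectangle y :&: rectangle z) = 1.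

Lemma is_cover_add Z p y :
  is_cover k.-1 (p |: Z) y = is_cover k.-1 Z y && (p \notin rectangle y).
Proof.
rewrite /is_cover inE -negb_or negbK andbAC; congr (_ && _).
apply/coversP/andP => [h|[/coversP h py] q].
  split; last by apply: h; rewrite !inE eqxx.
  by apply/coversP => q qZ; apply: h; rewrite !inE qZ orbT.
by rewrite !inE => /orP[/eqP ->//|/h].
Qed.

(** Decomposition at the first jump: the chain stays in [b] for a mean time [1 / I(b)], then [p]
    becomes a zero with probability [a_p / I(b)]. The factor [is_cover] discards the values of [v p]
    off the covers of [p |: Z], on which [is_occupation] says nothing. *)
Definition occupation_step Z b (v : 'I_m * 'I_n -> {set 'I_m} * {set 'I_n} -> R)
    (y : {set 'I_m} * {set 'I_n}) : R :=
  (y == b)%:R / rate_of a (rectangle b) +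
  \sum_(p in rectangle b) a p.1 p.2 / rate_of a (rectangle b) *
    (v p y *+ is_cover k.-1 (p |: Z) y).

Variables (Z : {set 'I_m * 'I_n}) (b : {set 'I_m} * {set 'I_n}).
Variable v : 'I_m * 'I_n -> {set 'I_m} * {set 'I_n} -> R.
Hypotheses (bZ : is_cover k.-1 Z b)
  (bmin : forall y, is_cover k.-1 Z y -> cover_le b y).
Hypothesis b0 : rate_of a (rectangle b) != 0.

Lemma occupation_step_sum (C : pred ({set 'I_m} * {set 'I_n})) (g : {set 'I_m} * {set 'I_n} -> R) :
  C b ->
  \sum_(y | is_cover k.-1 Z y && C y) occupation_step Z b v y * g y =
  g b / rate_of a (rectangle b) +
  \sum_(p in rectangle b) a p.1 p.2 / rate_of a (rectangle b) *
    \sum_(y | is_cover k.-1 (p |: Z) y && C y) v p y * g y.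
Proof.
move=> Cb; under eq_bigr do rewrite mulrDl mulr_suml.
rewrite big_split/=; congr (_ + _).
  rewrite (bigD1 b) ?bZ//= eqxx mul1r mulrC big1 ?addr0// => y /andP[_ /negbTE ->].
  by rewrite !mul0r.
rewrite exchange_big/=; apply: eq_bigr => p _; rewrite mulr_sumr.
rewrite (bigID (fun y => p \notin rectangle y))/= [X in _ + X]big1 ?addr0; last first.
  by move=> y /andP[/andP[_ _] py]; rewrite is_cover_add (negbTE py) andbF mulr0n mulr0 mul0r.
apply: eq_big => [y|y /andP[/andP[yZ _] py]]; first by rewrite is_cover_add andbAC.
by rewrite is_cover_add yZ py mulr1n mulrA.
Qed.

(** Split according to the first new zero [p]. If [p] is outside the rectangle of [z], then [z] is
    still critical and the inner sum is 1. If [p] is inside, every [y] between [b] and [z] has [p]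
    in its rectangle, so the inner sum is empty; the share [I(b ∩ z) / I(b)] of these [p] is
    supplied by the time spent in [b]. *)
Lemma occupation_stepP :
  (forall p, p \in rectangle b -> is_occupation (p |: Z) (v p)) ->
  is_occupation Z (occupation_step Z b v).
Proof.
move=> vP z zZ; rewrite (@occupation_step_sum (fun y => cover_le y z)
  (fun y => rate_of a (rectangle y :&: rectangle z))) ?bmin//.
transitivity ((\sum_(p in rectangle b) a p.1 p.2) / rate_of a (rectangle b)); last exact: divff.
rewrite [RHS]mulr_suml [RHS](bigID (fun p => p \in rectangle z))/=; congr (_ + _).
  rewrite /rate_of mulr_suml; apply: eq_bigl => p; by rewrite inE.
rewrite (bigID (fun p => p \in rectangle z))/= [X in X + _]big1 ?add0r; last first.
  move=> p /andP[pb pz]; rewrite big1 ?mulr0// => y /andP[ypZ /andP[/fintype.subsetP yz _]].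
  move: ypZ; rewrite is_cover_add => /andP[yZ]; have /andP[_ /fintype.subsetP by1] := bmin yZ.
  move: pb pz; rewrite !inE => /andP[pb _] /andP[_ pz].
  rewrite negb_and !negbK => /orP[/by1|/yz]; first by rewrite (negbTE pb).
  by rewrite (negbTE pz).
apply: eq_bigr => p /andP[pb pz]; rewrite vP ?mulr1//.
by rewrite is_cover_add zZ.
Qed.

Lemma occupation_step_total :
  \sum_(y | is_cover k.-1 Z y) occupation_step Z b v y =
  (rate_of a (rectangle b))^-1 +
  \sum_(p in rectangle b) a p.1 p.2 / rate_of a (rectangle b) *
    \sum_(y | is_cover k.-1 (p |: Z) y) v p y.
Proof.
have := @occupation_step_sum xpredT (fun=> 1) isT; rewrite mul1r => h.
transitivity (\sum_(y | is_cover k.-1 Z y && true) occupation_step Z b v y * 1).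
  by apply: eq_big => y; rewrite ?andbT// mulr1.
rewrite h; congr (_ + _); apply: eq_bigr => p _; congr (_ * _).
by apply: eq_big => y; rewrite ?andbT// mulr1.
Qed.

End occupation.

(** * Competing exponential variables *)

Section exponential_race.
Context (R : realType).
Implicit Types (x y b c : R).

(** The limit in [j], obtained from [1 + u <= expR u] and the Archimedean property. *)
Lemma ler_addexp_decay x y c b : 0 < b ->
  (forall j : nat, x <= y + c * expR (- (b * j%:R))) -> x <= y.
Proof.
move=> b0 h; rewrite leNgt; apply/negP => yx.
have e0 : 0 < x - y by rewrite subr_gt0.
have [j jE] : exists j : nat, c / ((x - y) * b) < j%:R.
  by exists (Num.bound `|c / ((x - y) * b)|); exact: le_lt_trans (ler_norm _) (archi_boundP (normr_ge0 _)).
have c_lt : c < (x - y) * (b * j%:R).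
  by move: jE; rewrite ltr_pdivrMr ?mulr_gt0// mulrC mulrA.
have h1 : (x - y) <= c * expR (- (b * j%:R)) by rewrite lerBlDl.
have h2 : (x - y) * expR (b * j%:R) <= c.
  apply: le_trans (ler_wpM2r (expR_ge0 _) h1) _.
  by rewrite -mulrA -expRD addNr expR0 mulr1.
have := le_lt_trans h2 c_lt; rewrite ltr_pM2l//.
by have := expR_ge1Dx (b * j%:R); lra.
Qed.

Lemma onemexpR_le x : 1 - expR (- x) <= x.
Proof. by have := expR_ge1Dx (- x); lra. Qed.

Lemma onemexpR_ge x : x * expR (- x) <= 1 - expR (- x).
Proof.
have := ler_wpM2r (expR_ge0 (- x)) (expR_ge1Dx x).
by rewrite -expRD subrr expR0; lra.
Qed.

(* The hypotheses bound the increments of [F] by those of [V * expR (- g * s)],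
   where [g = b + c] and [V = K * b / g], up to the factors [expR (- g * h)] and
   [expR (g * h)]. *)
Lemma exponential_race (F : R -> R) (K C b c : R) : 0 < b -> 0 <= c -> 0 <= K ->
  (forall s h, 0 <= s -> 0 < h ->
    K * (expR (- b * s) - expR (- b * (s + h))) * expR (- c * (s + h)) <= F s - F (s + h)
    <= K * (expR (- b * s) - expR (- b * (s + h))) * expR (- c * s)) ->
  (forall s, 0 <= s -> 0 <= F s <= C * expR (- b * s)) ->
  F 0 = K * b / (b + c).
Proof.
move=> b0 c0 K0 incF decF; set g := b + c; set V := K * b / g.
have g0 : 0 < g by rewrite ltr_pwDl.
have V0 : 0 <= V by rewrite divr_ge0 ?mulr_ge0 ?(ltW b0) ?(ltW g0).
have Vg : V * g = K * b by rewrite /V divfK// gt_eqF.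
have split_exp (s h : R) : expR (- b * s) - expR (- b * (s + h)) =
    expR (- b * s) * (1 - expR (- (b * h))).
  by rewrite mulrDr expRD mulrBr mulr1 (mulNr b h).
have exp_g (s : R) : expR (- (g * s)) = expR (- b * s) * expR (- c * s).
  by rewrite -expRD /g; congr expR; ring.
(* Both comparisons rest on [u * expR (- u) <= 1 - expR (- u) <= u], taken at [g * h] and [b * h],
   and on [V * g = K * b]. *)
have inc_lo s h : 0 <= s -> 0 < h ->
    V * expR (- (g * h)) * (expR (- (g * s)) - expR (- (g * (s + h)))) <= F s - F (s + h).
  move=> s0 h0; have /andP[+ _] := incF s h s0 h0; apply: le_trans.
  have -> : V * expR (- (g * h)) * (expR (- (g * s)) - expR (- (g * (s + h)))) =
      expR (- (g * s)) * expR (- (g * h)) * (V * (1 - expR (- (g * h)))).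
    by rewrite (mulrDr g) (opprD (g * s)) (expRD (- (g * s))); ring.
  have -> : K * (expR (- b * s) - expR (- b * (s + h))) * expR (- c * (s + h)) =
      expR (- (g * s)) * (expR (- (c * h)) * (K * (1 - expR (- (b * h))))).
    by rewrite split_exp exp_g (mulrDr (- c)) (expRD (- c * s)) (mulNr c h); ring.
  rewrite -mulrA ler_wpM2l ?expR_ge0//.
  have -> : expR (- (g * h)) = expR (- (c * h)) * expR (- (b * h)).
    by rewrite -expRD /g; congr expR; ring.
  rewrite -mulrA ler_wpM2l ?expR_ge0//.
  apply: (@le_trans _ _ (expR (- (b * h)) * (K * b * h))).
    rewrite ler_wpM2l ?expR_ge0// -Vg -mulrA ler_wpM2l//.
    by rewrite -expRD (_ : - (c * h) - b * h = - (g * h)) ?onemexpR_le// /g; ring.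
  by have := ler_wpM2l K0 (onemexpR_ge (b * h)); lra.
have inc_up s h : 0 <= s -> 0 < h ->
    F s - F (s + h) <= V * expR (g * h) * (expR (- (g * s)) - expR (- (g * (s + h)))).
  move=> s0 h0; have /andP[_] := incF s h s0 h0; move/le_trans; apply.
  have -> : V * expR (g * h) * (expR (- (g * s)) - expR (- (g * (s + h)))) =
      expR (- (g * s)) * (V * (expR (g * h) * (1 - expR (- (g * h))))).
    by rewrite (mulrDr g) (opprD (g * s)) (expRD (- (g * s))); ring.
  have -> : K * (expR (- b * s) - expR (- b * (s + h))) * expR (- c * s) =
      expR (- (g * s)) * (K * (1 - expR (- (b * h)))).
    by rewrite split_exp exp_g; ring.
  rewrite ler_wpM2l ?expR_ge0//; apply: (@le_trans _ _ (K * (b * h))).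
    by rewrite ler_wpM2l// onemexpR_le.
  rewrite mulrA -Vg -mulrA ler_wpM2l//.
  have := ler_wpM2l (expR_ge0 (g * h)) (onemexpR_ge (g * h)).
  by rewrite mulrCA -expRD subrr expR0 mulr1.
(* Adding [j] slices telescopes. Since [F] decays exponentially, the remainders then disappear as
   [j] grows. *)
have sum_lo h (j : nat) : 0 < h ->
    V * expR (- (g * h)) * (1 - expR (- (g * h * j%:R))) <= F 0 - F (h * j%:R).
  move=> h0; elim: j => [|j IH]; first by rewrite !mulr0 oppr0 expR0 !subrr mulr0.
  have := inc_lo (h * j%:R) h; rewrite mulr_ge0 ?(ltW h0)// => /(_ isT h0).
  by rewrite -natr1 !mulrDr !mulr1 !mulrA; lra.
have sum_up h (j : nat) : 0 < h ->
    F 0 - F (h * j%:R) <= V * expR (g * h) * (1 - expR (- (g * h * j%:R))).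
  move=> h0; elim: j => [|j IH]; first by rewrite !mulr0 oppr0 expR0 !subrr mulr0.
  have := inc_up (h * j%:R) h; rewrite mulr_ge0 ?(ltW h0)// => /(_ isT h0).
  by rewrite -natr1 !mulrDr !mulr1 !mulrA; lra.
have lo h : 0 < h -> V * expR (- (g * h)) <= F 0.
  move=> h0; apply: (@ler_addexp_decay _ _ (V * expR (- (g * h))) (g * h)); first exact: mulr_gt0.
  move=> j; have := sum_lo h j h0.
  have /andP[+ _] : 0 <= F (h * j%:R) <= C * expR (- b * (h * j%:R)).
    by apply: decF; rewrite mulr_ge0 ?(ltW h0).
  by lra.
have up h : 0 < h -> F 0 <= V * expR (g * h).
  move=> h0; apply: (@ler_addexp_decay _ _ C (b * h)); first exact: mulr_gt0.
  move=> j; have := sum_up h j h0.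
  have /andP[_] : 0 <= F (h * j%:R) <= C * expR (- b * (h * j%:R)).
    by apply: decF; rewrite mulr_ge0 ?(ltW h0).
  have : 0 <= V * expR (g * h) * expR (- (g * h * j%:R)) by exact: mulr_ge0 (mulr_ge0 V0 (expR_ge0 _)) (expR_ge0 _).
  by rewrite mulNr mulrA; lra.
apply/le_anti/andP; split.
  apply/ler_addgt0Pr => e e0.
  (* With [h = e / (F 0 * g + 1)] the error [F 0 * g * h] is at most [e]; the summand 1 keeps the
     denominator positive. *)
  have W0 : 0 < F 0 * g + 1.
    by rewrite ltr_wpDl// mulr_ge0 ?(ltW g0)//; have /andP[] := decF 0 (lexx _).
  have /up h1 : 0 < e / (F 0 * g + 1) by rewrite divr_gt0.
  set h := e / _ in h1; have h0 : 0 < h by rewrite divr_gt0.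
  have h2 : F 0 * expR (- (g * h)) <= V.
    by have := ler_wpM2r (expR_ge0 (- (g * h))) h1; rewrite -mulrA -expRD subrr expR0 mulr1.
  have F00 : 0 <= F 0 by have /andP[] := decF 0 (lexx _).
  have h3 := ler_wpM2l F00 (expR_ge1Dx (- (g * h))).
  have hE : h * (F 0 * g + 1) = e by rewrite /h divfK// gt_eqF.
  by nra.
apply/ler_addgt0Pr => e e0.
have W0 : 0 < V * g + 1 by rewrite ltr_wpDl// mulr_ge0 ?(ltW g0).
have /lo h1 : 0 < e / (V * g + 1) by rewrite divr_gt0.
set h := e / _ in h1; have h0 : 0 < h by rewrite divr_gt0.
have h3 := ler_wpM2l V0 (expR_ge1Dx (- (g * h))).
have hE : h * (V * g + 1) = e by rewrite /h divfK// gt_eqF.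
by nra.
Qed.

End exponential_race.

Lemma measurable_bigmin d (T : measurableType d) (R : realType) (J : Type)
    (s : seq J) (Q : pred J) (f : J -> T -> R) (f0 : T -> R) :
  measurable_fun setT f0 -> (forall j, measurable_fun setT (f j)) ->
  measurable_fun setT (fun w => \big[Num.min/f0 w]_(j <- s | Q j) f j w).
Proof.
move=> mf0 mf; elim: s => [|j s IH]; first by under eq_fun do rewrite big_nil.
under eq_fun do rewrite big_cons.
by case: (Q j) => //; exact: (measurable_minr (mf j) IH).
Qed.

(** * Lack of memory for families of independent exponential variables *)

Section exponential_family.
Context (R : realType) (d : measure_display) (T : measurableType d)
  (P : probability T R) (I : finType).
Implicit Types (D : set T) (X : I -> T -> R) (a t : I -> R) (Z S : {set I}).
Local Open Scope classical_set_scope.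

Definition exceed D Z X t : set T :=
  D `&` [set w | forall p, p \notin Z -> t p < X p w].

(* The variables are exponential and independent "relatively to D", of mass c:
   using the restrictions of P to events avoids conditional probabilities. *)
Record exponential_on D (c : R) Z a X : Prop := ExponentialOn {
  expon_measurable : measurable D;
  expon_measurable_fun : forall p, measurable_fun setT (X p);
  expon_eq0 : forall w, D w -> forall p, p \in Z -> X p w = 0;
  expon_gt0 : forall w, D w -> forall p, p \notin Z -> 0 < X p w;
  expon_tail : forall t, (forall p, 0 <= t p) ->
    P (exceed D Z X t) = (c * expR (- \sum_(p in ~: Z) a p * t p))%:E }.

Let pr (A : set T) : R := fine (P A).

Let prE A : measurable A -> P A = (pr A)%:E.
Proof. by move=> mA; rewrite /pr fineK// fin_num_measure. Qed.

Let prD A B : measurable A -> measurable B -> B `<=` A ->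
  pr (A `\` B) = pr A - pr B.
Proof.
move=> mA mB BA; have := measureD mA mB; rewrite (setIidr BA) => h.
apply: EFin_inj; rewrite EFinB -!prE//; last exact: measurableD.
by rewrite h// (le_lt_trans (probability_le1 P mA)) ?ltry.
Qed.

Let pr_le A B : measurable A -> measurable B -> A `<=` B -> pr A <= pr B.
Proof. by move=> mA mB AB; rewrite -lee_fin -!prE// le_measure// inE. Qed.

Lemma measurable_gt_fun (f g : T -> R) : measurable_fun setT f -> measurable_fun setT g ->
  measurable [set w | f w < g w].
Proof.
move=> mf mg; rewrite -[X in measurable X]setTI.
exact: (measurable_fun_ltr mf mg measurableT (Y := [set true])).
Qed.

Lemma measurable_forall_fin (Q : pred I) (A : I -> set T) :
  (forall p, Q p -> measurable (A p)) -> measurable [set w | forall p, Q p -> A p w].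
Proof.
move=> mA; rewrite (_ : [set _ | _] = \bigcap_(p in [set p | Q p]) A p)//.
by apply: fin_bigcap_measurable.
Qed.

Lemma measurable_exceed D Z X t : measurable D ->
  (forall p, measurable_fun setT (X p)) -> measurable (exceed D Z X t).
Proof.
move=> mD mX; apply: measurableI => //; apply: measurable_forall_fin => p _.
by apply: measurable_gt_fun => //; exact: measurable_cst.
Qed.

Definition race_event D S X p : set T :=
  D `&` [set w | forall q, q \in S :\ p -> X p w < X q w].

(** On [race_event D S X p], with [p] in [S], this subtracts the minimum over [S] from the variables
    in [S]. *)
Definition race_shift S X p (q : I) (w : T) : R :=
  X q w - X p w *+ (q \in S).

Lemma expon_mass D c Z a X : exponential_on D c Z a X -> P D = c%:E.
Proof.
move=> XE; have := expon_tail XE (fun=> lexx 0); rewrite big1 ?oppr0 ?expR0 ?mulr1 => [|p _]; last by rewrite mulr0.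
move=> <-; congr (P _); apply/seteqP; split=> [w Dw|w []//].
by split=> // p pZ; exact: expon_gt0 XE _ _ _ _.
Qed.

Section race.
Variables (D : set T) (c : R) (Z S : {set I}) (a : I -> R) (X : I -> T -> R).
Hypothesis XE : exponential_on D c Z a X.
Hypotheses (c_ge0 : 0 <= c) (a_gt0 : forall p, p \notin Z -> 0 < a p).
Hypothesis SZ : forall p, p \in S -> p \notin Z.

Let mD := expon_measurable XE.
Let mX := expon_measurable_fun XE.

Lemma measurable_race_event p : measurable (race_event D S X p).
Proof.
by apply: measurableI => //; apply: measurable_forall_fin => q _; exact: measurable_gt_fun.
Qed.

Lemma measurable_race_shift p q : measurable_fun setT (race_shift S X p q).
Proof.
apply: measurable_funB => //; case: (q \in S) => /=.
  by rewrite (_ : (fun x : T => X p x *+ 1) = X p).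
by rewrite (_ : (fun x : T => X p x *+ 0) = fun=> 0).
Qed.

(** Lack of memory: once [p] has won, the shifted variables are again independent and exponential,
    with [p] as a new zero. For the tail event [E], let [F s] be the probability of [E] with
    [X p > s]; its increments lie between differences of joint tails, and [exponential_race] then
    gives [F 0]. *)
Lemma race_law p : p \in S ->
  exponential_on (race_event D S X p) (c * a p / \sum_(q in S) a q) (p |: Z) a
    (race_shift S X p).
Proof.
move=> pS; have pZ := SZ pS.
split.
- exact: measurable_race_event.
- exact: measurable_race_shift.
- move=> w [Dw _] q; rewrite /race_shift !inE => /orP[/eqP ->|qZ]; first by rewrite pS subrr.
  rewrite (expon_eq0 XE Dw qZ); case: (boolP (q \in S)) => [/SZ|_]; first by rewrite qZ.
  by rewrite mulr0n subr0.
- move=> w [Dw pmin] q; rewrite /race_shift !inE negb_or => /andP[qp qZ].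
  case: (boolP (q \in S)) => [qS|_]; last by rewrite mulr0n subr0; exact: expon_gt0 XE _ _ _ _.
  by rewrite mulr1n subr_gt0; apply: pmin; rewrite !inE qp.
move=> t t0; set E := exceed _ _ _ _.
have mE : measurable E.
  by apply: measurable_exceed; [exact: measurable_race_event|exact: measurable_race_shift].
pose A' := \sum_(q in S :\ p) a q.
pose W := \sum_(q in ~: (p |: Z)) a q * t q.
(* Thresholds: [s] for [p], the shifted [u + t q] for its competitors in [S], and [t q]
   elsewhere. *)
pose tau s u q : R := if q == p then s else if q \in S then u + t q else t q.
have tau0 s u q : 0 <= s -> 0 <= u -> 0 <= tau s u q.
  by move=> s0 u0; rewrite /tau; case: eqP => // _; case: ifP => // _; rewrite addr_ge0.
have tau_sum s u : \sum_(q in ~: Z) a q * tau s u q = a p * s + A' * u + W.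
  rewrite (bigD1 p) ?inE//= /tau eqxx -addrA; congr (_ + _).
  rewrite /A' /W mulr_suml big_mkcond/= [X in _ = X + _]big_mkcond [X in _ = _ + X]big_mkcond/= -big_split/=.
  apply: eq_bigr => q _; rewrite !inE.
  case: (boolP (q == p)) => qp /=; rewrite ?andbF ?addr0//= ?andbT.
  case: (boolP (q \in S)) => [/SZ ->|_]; first by rewrite mulrDr.
  by case: (q \in Z) => /=; rewrite add0r.
have tail s u : 0 <= s -> 0 <= u ->
    pr (exceed D Z X (tau s u)) = c * expR (- (a p * s + A' * u + W)).
  move=> s0 u0; apply: EFin_inj; rewrite -prE -?tau_sum; [apply: expon_tail XE _ _ => q|exact: measurable_exceed].
  exact: tau0.
have mTS s u : measurable (exceed D Z X (tau s u)) by exact: measurable_exceed.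
pose F s := pr (E `&` [set w | s < X p w]).
have mF s : measurable (E `&` [set w | s < X p w]).
  by apply: measurableI => //; apply: measurable_gt_fun => //; exact: measurable_cst.
have F0 : pr E = F 0.
  congr pr; apply/seteqP; split=> [w Ew|w []//]; split=> //=.
  by apply: (expon_gt0 XE) => //; case: Ew => -[].
have E1 w : E w -> D w /\ forall q, q \notin Z -> q != p ->
    (if q \in S then X p w + t q else t q) < X q w.
  case=> -[Dw _] h; split=> // q qZ qp; have := h q; rewrite /race_shift !inE negb_or qp qZ => /(_ isT).
  by case: (q \in S); rewrite ?mulr1n ?mulr0n ?subr0// ltrBrDl.
have E2 w : D w -> (forall q, q \notin Z -> q != p ->
    (if q \in S then X p w + t q else t q) < X q w) -> E w.
  move=> Dw h; split.
    split=> // q; rewrite !inE => /andP[qp qS]; have := h q (SZ qS) qp; rewrite qS.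
    by apply: le_lt_trans; rewrite lerDl.
  move=> q; rewrite !inE negb_or /race_shift => /andP[qp qZ]; have := h q qZ qp.
  by case: (q \in S); rewrite ?mulr1n ?mulr0n ?subr0// ltrBrDl.
have FB s h : 0 < h -> F s - F (s + h) = pr ((E `&` [set w | s < X p w]) `\` (E `&` [set w | s + h < X p w])).
  move=> h0; rewrite prD// => w [Ew /= sw]; split=> //=; apply: lt_trans sw; by rewrite ltrDl.
have TSB s h u : 0 <= s -> 0 < h -> 0 <= u ->
    c * expR (- W) * (expR (- a p * s) - expR (- a p * (s + h))) * expR (- A' * u) =
    pr (exceed D Z X (tau s u) `\` exceed D Z X (tau (s + h) u)).
  move=> s0 h0 u0; rewrite prD//; last first.
    move=> w [Dw sw]; split=> // q qZ; apply: le_lt_trans (sw q qZ).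
    by rewrite /tau; case: eqP => // _; rewrite lerDl ltW.
  rewrite !tail ?addr_ge0 ?(ltW h0)// !opprD !expRD !mulNr; ring.
have -> : (c * a p / (\sum_(q in S) a q) * expR (- \sum_(q in ~: (p |: Z)) a q * t q))%:E =
    (c * expR (- W) * a p / (a p + A'))%:E.
  by rewrite (big_setD1 p)//= -/A' -/W; congr EFin; ring.
rewrite prE// F0; congr EFin.
apply: (@exponential_race _ F _ c) => //.
- exact: a_gt0.
- by apply: sumr_ge0 => q; rewrite !inE => /andP[_ /SZ/a_gt0/ltW].
- by rewrite mulr_ge0 ?expR_ge0.
(* Let [s < X p <= s + h]. On [D], having [X q > s + h + t q] for the competitors, along with the
   other thresholds, suffices for [E]; conversely [E] forces [X q > s + t q]. So [u = s + h] and
   [u = s] give the two bounds. *)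
- move=> s h s0 h0; have sh0 : 0 <= s + h by rewrite addr_ge0 ?(ltW h0).
  rewrite !TSB ?FB//; apply/andP; split; apply: pr_le; do ?exact: measurableD.
    move=> w [[Dw h1] h2].
    have sX : s < X p w by have := h1 p pZ; rewrite /tau eqxx.
    have Xsh : X p w <= s + h.
      rewrite leNgt; apply/negP => shX; apply: h2; split=> // q qZ.
      by have := h1 q qZ; rewrite /tau; case: (q =P p) => [->|].
    split; last by move=> [_ /=]; rewrite ltNge Xsh.
    split=> //; apply: E2 => // q qZ qp; have := h1 q qZ; rewrite /tau (negbTE qp).
    by case: (q \in S) => //; apply: le_lt_trans; rewrite lerD2r.
  move=> w [[Ew /= sX] h2]; have [Dw h1] := E1 _ Ew.
  split.
    split=> // q qZ; rewrite /tau; case: eqP => [->//|/eqP qp].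
    have := h1 q qZ qp; case: (q \in S) => //; apply: lt_trans; by rewrite ltrD2r.
  move=> [_ h3]; apply: h2; split=> //=; by have := h3 p pZ; rewrite /tau eqxx.
(* The decay follows from the tail of [X p] alone. *)
- move=> s s0; rewrite fine_ge0//=.
  pose t1 q : R := if q == p then s else 0.
  have t10 q : 0 <= t1 q by rewrite /t1; case: eqP.
  have -> : c * expR (- a p * s) = pr (exceed D Z X t1).
    apply: EFin_inj; rewrite -prE; last exact: measurable_exceed.
    rewrite (expon_tail XE t10) (bigD1 p) ?inE//= big1 => [|q /andP[_ qp]].
      by rewrite addr0 /t1 eqxx mulNr.
    by rewrite /t1 (negbTE qp) mulr0.
  apply: pr_le => //; first exact: measurable_exceed.
  move=> w [Ew /= sX]; have [Dw _] := E1 _ Ew; split=> // q qZ; rewrite /t1.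
  by case: eqP => [->//|_]; exact: (expon_gt0 XE).
Qed.

Let rate := \sum_(q in S) a q.

Lemma race_rate_gt0 p : p \in S -> 0 < rate.
Proof.
move=> pS; rewrite /rate (big_setD1 p)//= ltr_pwDl ?a_gt0 ?SZ//.
by apply: sumr_ge0 => q; rewrite !inE => /andP[_ /SZ/a_gt0/ltW].
Qed.

(** Ties are negligible: the race events are disjoint and their masses, given by [race_law], already
    add up to the mass [c] of [D]. *)
Lemma race_integral (f : T -> \bar R) : (exists p, p \in S) -> measurable_fun D f ->
  (forall w, D w -> 0 <= f w)%E ->
  (\int[P]_(w in D) f w = \sum_(p in S) \int[P]_(w in race_event D S X p) f w)%E.
Proof.
case=> p0 p0S mf f0; pose U := \big[setU/set0]_(p <- enum S) race_event D S X p.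
have tI : trivIset [set` enum S] (race_event D S X).
  move=> p q; rewrite /= !mem_enum => pS qS [w [[_ wp] [_ wq]]]; apply/eqP; apply: contraT => pq.
  have := wp q; rewrite !inE eq_sym pq => /(_ qS) h1.
  by have := wq p; rewrite !inE pq => /(_ pS) /lt_trans /(_ h1); rewrite ltxx.
have UD : U `<=` D.
  by rewrite /U; elim/big_ind: _ => [//|A B AD BD|p _ w []//]; rewrite subUset.
have mU : measurable U by apply: bigsetU_measurable => p _; exact: measurable_race_event.
have PU : P U = c%:E.
  have : (\int[P]_(w in U) cst 1 w =
      \sum_(p <- enum S) \int[P]_(w in race_event D S X p) cst 1 w)%E.
    apply: ge0_integral_bigsetU => //; first exact: measurable_race_event.
    exact: enum_uniq.
  rewrite integral_cst// mul1e => ->.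
  rewrite big_enum/= (eq_bigr (fun p => (c * a p / \sum_(q in S) a q)%:E)); last first.
    move=> p pS; rewrite -(expon_mass (race_law pS)) integral_cst ?mul1e//.
    exact: measurable_race_event.
  rewrite sumEFin -mulr_suml -mulr_sumr mulfK//.
  by rewrite gt_eqF// (race_rate_gt0 p0S).
rewrite (@ge0_negligible_integral _ _ _ P D (D `\` U))//; [|exact: measurableD|].
  rewrite setDD (setIidr UD) ge0_integral_bigsetU//.
  - by rewrite big_enum.
  - exact: measurable_race_event.
  - exact: enum_uniq.
  - exact: measurable_funS mf.
  - by move=> w /UD; exact: f0.
have PDU : P (D `\` U) = 0%:E.
  by rewrite prE ?prD//; [rewrite /pr (expon_mass XE) PU subrr|exact: measurableD].
exact: PDU.
Qed.

(** The starting value [X p0] does not affect the minimum when [p0] is in [S], as in all the lemmas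
    below. *)
Definition race_time p0 (w : T) : R := \big[Num.min/X p0 w]_(q in S) X q w.

Lemma race_time_gt p0 w r : p0 \in S ->
  (r < race_time p0 w) <-> forall q, q \in S -> r < X q w.
Proof.
move=> p0S; split=> [h q qS|h]; last by apply: lt_bigmin => //; exact: h.
by apply: lt_le_trans h _; apply: bigmin_le_cond.
Qed.

Lemma race_timeE p0 p w : p0 \in S -> p \in S -> race_event D S X p w ->
  race_time p0 w = X p w.
Proof.
move=> p0S pS [_ wp]; have {}wp q : q \in S -> X p w <= X q w.
  by have [->//|qp] := eqVneq q p => qS; apply/ltW/wp; rewrite !inE qp.
apply/le_anti; rewrite bigmin_le_cond//=; apply: le_bigmin; first exact: wp.
by move=> q; exact: wp.
Qed.

(** The minimum over [S] has tail [c * expR (- rate * r)], which is [c / rate] times an exponential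
    density; integrate the tail. *)
Lemma integral_race_time p0 : p0 \in S ->
  (\int[P]_(w in D) (race_time p0 w)%:E = (c / rate)%:E)%E.
Proof.
move=> p0S; have rate0 := race_rate_gt0 p0S.
have mxi : measurable_fun setT (race_time p0) by exact: measurable_bigmin.
(* Cutting off outside [D] gives a nonnegative random variable on the whole space, to which the tail
   formula for expectations applies. *)
pose Y w : R := race_time p0 w * \1_D w.
have mY : measurable_fun setT Y by apply: measurable_funM => //; exact: measurable_indic.
pose Ym := isMeasurableFun.Build _ _ _ _ Y mY.
pose Y' : {RV P >-> R} := HB.pack Y Ym.
have Y0 w : 0 <= Y' w.
  rewrite /Y' /= /Y indicE; case: (boolP (w \in D)) => [/set_mem Dw|_]; last by rewrite mulr0.
  by rewrite mulr1; apply: le_bigmin => [|q qS]; apply/ltW/(expon_gt0 XE) => //; exact: SZ.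
rewrite integral_mkcond.
transitivity 'E_P[Y']%E.
  by rewrite expectation_def; apply: eq_integral => w _; rewrite /= /Y indicE patchE; case: ifP; rewrite ?mulr1 ?mulr0.
rewrite ge0_expectation_ccdf//.
have tailY r : 0 <= r -> ccdf Y' r = (c * expR (- rate * r))%:E.
  move=> r0; pose t q : R := if q \in S then r else 0.
  have t0 q : 0 <= t q by rewrite /t; case: ifP.
  rewrite (_ : - rate * r = - \sum_(q in ~: Z) a q * t q); last first.
    rewrite mulNr mulr_suml; congr (- _); rewrite big_mkcond [RHS]big_mkcond/=.
    apply: eq_bigr => q _; rewrite !inE /t; case: (boolP (q \in S)) => [/SZ ->//|_].
    by rewrite mulr0; case: ifP.
  rewrite -(expon_tail XE t0) /ccdf /distribution /pushforward; congr (P _).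
  apply/seteqP; split=> [w|w [Dw h]] /=; rewrite in_itv/= andbT /Y indicE.
    case: (boolP (w \in D)) => [/set_mem Dw|_]; last by rewrite mulr0 ltNge r0.
    rewrite mulr1 => rw.
    split=> // q qZ; rewrite /t; case: ifP => [qS|_]; last exact: (expon_gt0 XE).
    exact: (race_time_gt _ _ p0S).1.
  rewrite mem_set// mulr1; apply/(race_time_gt _ _ p0S) => q qS.
  by have := h q (SZ qS); rewrite /t qS.
transitivity (\int[lebesgue_measure]_(r in `[0%R, +oo[) ((c / rate)%:E * (exponential_pdf rate r)%:E))%E.
  apply: eq_integral => r; rewrite inE/= in_itv/= andbT => r0.
  rewrite tailY// exponential_pdfE// -EFinM; congr EFin.
  by rewrite mulrA divfK// gt_eqF.
rewrite ge0_integralZl//=.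
- transitivity ((c / rate)%:E * \int[lebesgue_measure]_r (exponential_pdf rate r)%:E)%E.
    congr (_ * _)%E; rewrite integral_mkcond; apply: eq_integral => r _ /=.
    rewrite patchE; case: ifPn => // /negP h; rewrite lt0_exponential_pdf// ltNge.
    by apply/negP => r0; apply: h; rewrite inE/= in_itv/= r0.
  by rewrite integral_exponential_pdf// mule1.
- by apply/measurable_EFinP; apply: measurable_funTS; exact: measurable_exponential_pdf.
- by move=> r _; rewrite lee_fin exponential_pdf_ge0// ltW.
- by rewrite lee_fin divr_ge0// ltW.
Qed.

End race.
End exponential_family.

(** * Expectation of the minimal assignment *)

Lemma rectangle_neq0 (m n k : nat) (b : {set 'I_m} * {set 'I_n}) :
  (0 < k)%N -> (k <= minn m n)%N ->
  (#|b.1| + #|b.2| = k.-1)%N -> exists p, p \in rectangle b.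
Proof.
move=> k_gt0 k_le bk; have ex q (B : {set 'I_q}) : (#|B| < q)%N -> exists i, i \notin B.
  move=> Bq; apply/existsP; rewrite -negb_forall; apply/negP => /forallP h.
  have : (q <= #|B|)%N.
    by rewrite -[X in (X <= _)%N]card_ord; apply/subset_leq_card/fintype.subsetP => i _; exact: h.
  by rewrite leqNgt Bq.
have [km kn] : (k <= m)%N /\ (k <= n)%N by move: k_le; rewrite leq_min => /andP.
have [i ib] : exists i, i \notin b.1 by apply: ex; lia.
have [j jb] : exists j, j \notin b.2 by apply: ex; lia.
by exists (i, j); rewrite inE /= ib jb.
Qed.

Section expected_min_assignment.
Context (R : realType) (d : measure_display) (T : measurableType d)
  (P : probability T R) (m n k : nat) (a : 'M[R]_(m, n)) (A0 : {set 'I_m * 'I_n}).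
Hypotheses (k_gt0 : (0 < k)%N) (k_le : (k <= minn m n)%N).
Hypothesis A0k : is_assignment k.-1 A0.
Implicit Types (D : set T) (X : 'I_m * 'I_n -> T -> R) (Z : {set 'I_m * 'I_n}).
Local Open Scope classical_set_scope.

Definition matrix_at X (w : T) : 'M[R]_(m, n) := \matrix_(i, j) X (i, j) w.

Lemma measurable_min_assignment X : (forall p, measurable_fun setT (X p)) ->
  measurable_fun setT (fun w => min_assignment k (matrix_at X w)).
Proof.
move=> mX; have [B0 B0k] := exists_assignment k_le.
rewrite (_ : (fun w => _) = fun w =>
  \big[Num.min/assignment_value (matrix_at X w) B0]_(A : {set 'I_m * 'I_n} | is_assignment k A)
    assignment_value (matrix_at X w) A).
  have mA A : measurable_fun setT (fun w => assignment_value (matrix_at X w) A).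
    rewrite /assignment_value; under eq_fun do rewrite big_mkcond/=.
    apply: measurable_sum => p; case: (p \in A) => //.
    by under eq_fun do rewrite mxE -surjective_pairing; exact: mX.
  exact: measurable_bigmin.
apply/funext => w; have [[A kA minE] minB] := min_assignment_is_min (matrix_at X w) k_le.
apply/le_anti/andP; split; first by apply: le_bigmin => [|B]; exact: minB.
by rewrite minE; apply: bigmin_le_cond.
Qed.

(** Induction on the number of positions outside [Z]. The event [D] and its mass [c] vary because
    the induction hypothesis is applied on each race event. The occupation vector [v] is built along
    the same recursion. *)
Theorem integral_min_assignment l Z D c X : (#|~: Z| < l)%N -> A0 \subset Z ->
  (forall p, p \notin Z -> 0 < a p.1 p.2) -> 0 <= c ->
  exponential_on P D c Z (fun p => a p.1 p.2) X ->
  exists2 v, is_occupation k a Z v &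
    (\int[P]_(w in D) (min_assignment k (matrix_at X w))%:E =
     (c * \sum_(y | is_cover k.-1 Z y) v y)%:E)%E.
Proof.
elim: l Z D c X => // l IH Z D c X Zl A0Z a_gt0 c0 XE.
have mX := expon_measurable_fun XE; have mD := expon_measurable XE.
have X_ge0 w p : D w -> 0 <= X p w.
  move=> Dw; have [pZ|pZ] := boolP (p \in Z); first by rewrite (expon_eq0 XE).
  by rewrite ltW// (expon_gt0 XE).
have XZ w i j : D w -> (i, j) \in Z -> matrix_at X w i j = 0.
  by move=> Dw ijZ; rewrite mxE (expon_eq0 XE).
have [exQ|noQ] := pselect (exists b, is_cover k.-1 Z b); last first.
  (* With no critical rectangle left, the minimum is 0 and the occupation condition is vacuous. *)
  exists (fun=> 0); first by move=> z zZ; case: noQ; exists z.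
  rewrite big1 // mulr0 integral0_eq// => w Dw; congr EFin.
  apply: (min_assignment_eq0 A0Z A0k k_gt0 k_le noQ) => [i j|i j]; first exact: XZ.
  by rewrite mxE X_ge0.
have [b bZ bmin] := cover_min A0Z A0k exQ.
set S := rectangle b.
have /andP[bC /eqP bs] := bZ.
have SZ p : p \in S -> p \notin Z by exact: rectangle_disjoint.
have [p0 p0S] : exists p, p \in S by exact: rectangle_neq0 bs.
have rate0 := race_rate_gt0 a_gt0 SZ p0S.
have rate_ge0 := ltW rate0.
have /choice[v vP] p : exists v, p \in S -> is_occupation k a (p |: Z) v /\
    (\int[P]_(w in race_event D S X p) (min_assignment k (matrix_at (race_shift S X p) w))%:E =
     (c * a p.1 p.2 / rate_of a S * \sum_(y | is_cover k.-1 (p |: Z) y) v y)%:E)%E.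
  have [pS|] := boolP (p \in S); last by exists (fun=> 0).
  have pZ := SZ _ pS.
  have [|||||v vO vI] := IH (p |: Z) (race_event D S X p) (c * a p.1 p.2 / rate_of a S) (race_shift S X p).
  - apply: (@leq_trans #|~: Z|); last by rewrite -ltnS.
    apply: proper_card; rewrite properC; apply/properP.
    by split; [exact: finset.subsetUr|exists p; rewrite ?SZ// !inE eqxx].
  - by apply: fintype.subset_trans A0Z _; exact: finset.subsetUr.
  - by move=> q; rewrite !inE negb_or => /andP[_ /a_gt0].
  - by rewrite divr_ge0// mulr_ge0// ltW// a_gt0.
  - exact: race_law.
  by exists v => _; split.
exists (occupation_step k a Z b v).
  apply: occupation_stepP => //; first by rewrite gt_eqF.
  by move=> p pS; have [] := vP p pS.
pose xi := race_time S X p0.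
have xi0 w : D w -> 0 <= xi w.
  by move=> Dw; apply: le_bigmin => [|q _]; exact: X_ge0.
have mxi : measurable_fun setT xi by exact: measurable_bigmin.
(* The family after subtraction of the race time, defined without reference to the winner; on each
   race event it agrees with the corresponding [race_shift]. *)
pose X' q w := X q w - xi w *+ (q \in S).
have mX' q : measurable_fun setT (X' q).
  apply: measurable_funB => //; case: (q \in S) => /=.
    by rewrite (_ : (fun x : T => xi x *+ 1) = xi).
  by rewrite (_ : (fun x : T => xi x *+ 0) = fun=> 0).
have xi_le w p : p \in S -> xi w <= X p w by move=> pS; apply: bigmin_le_cond.
have X'_ge0 w p : D w -> 0 <= X' p w.
  move=> Dw; rewrite /X'; case: (boolP (p \in S)) => [pS|_].
    by rewrite mulr1n subr_ge0 xi_le.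
  by rewrite mulr0n subr0 X_ge0.
have minE w : D w ->
    min_assignment k (matrix_at X w) = xi w + min_assignment k (matrix_at X' w).
  move=> Dw; rewrite (min_assignment_subtract A0Z A0k k_gt0 k_le bZ bmin (xi0 _ Dw)).
  - by congr (_ + min_assignment k _); apply/matrixP => i j; rewrite !mxE.
  - by move=> i j; exact: XZ.
  - by move=> i j; rewrite mxE X_ge0.
  - by move=> i j ijS; rewrite mxE xi_le.
have min_ge0 w : D w -> 0 <= min_assignment k (matrix_at X' w).
  move=> Dw; have [[A _ ->] _] := min_assignment_is_min (matrix_at X' w) k_le.
  by apply: sumr_ge0 => p _; rewrite mxE X'_ge0.
have mmin := measurable_min_assignment mX'.
transitivity (\int[P]_(w in D) ((xi w)%:E + (min_assignment k (matrix_at X' w))%:E))%E.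
  by apply: eq_integral => w /set_mem Dw; rewrite minE// EFinD.
rewrite ge0_integralD//; first last.
- by apply/measurable_EFinP; exact: measurable_funTS.
- by apply/measurable_EFinP; exact: measurable_funTS.
rewrite (integral_race_time XE c0 a_gt0 SZ p0S).
rewrite (race_integral XE c0 a_gt0 SZ); first last.
- by move=> w Dw; rewrite lee_fin min_ge0.
- by apply/measurable_EFinP; exact: measurable_funTS.
- by exists p0.
rewrite (eq_bigr (fun p => (c * a p.1 p.2 / rate_of a S *
    \sum_(y | is_cover k.-1 (p |: Z) y) v p y)%:E)); last first.
  move=> p pS; rewrite -(vP p pS).2; apply: eq_integral => w /set_mem wp.
  congr (min_assignment k _)%:E; apply/matrixP => i j; rewrite !mxE /X' /race_shift.
  by rewrite /xi (race_timeE p0S pS wp).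
rewrite sumEFin -EFinD occupation_step_total ?gt_eqF//; congr EFin.
rewrite mulrDr mulr_sumr; congr (_ + _); apply: eq_bigr => p _.
by rewrite !mulrA.
Qed.

End expected_min_assignment.

(** * Passage to the poset of critical rectangles and to the random matrix *)

Lemma sum_critical (R : nmodType) (m n k : nat) (Z : {set 'I_m * 'I_n})
    (Q : pred ({set 'I_m} * {set 'I_n})) (F : {set 'I_m} * {set 'I_n} -> R) :
  \sum_(x : critical k Z | Q (cover_of x)) F (cover_of x) =
  \sum_(y | is_cover k.-1 Z y && Q y) F y.
Proof.
rewrite [RHS](reindex_omap (@cover_of m n k Z) insub) => [|y /andP[yZ _]]; last first.
  by rewrite insubT.
apply: eq_bigl => x; rewrite [insub _](valK x) eqxx andbT.
by rewrite (cover_ofP x).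
Qed.

Section joint_tails.
Context (R : realType) (d : measure_display) (T : measurableType d)
  (P : probability T R) (I : finType).
Local Open Scope classical_set_scope.

Lemma independent_exponential_tail (J : {set I}) (X : I -> {RV P >-> R}) (a t : I -> R) :
  mutually_independent J X ->
  (forall p, p \in J -> exponential_with_rate (a p) (X p)) ->
  (forall p, 0 <= t p) ->
  P [set w | forall p, p \in J -> t p < X p w] =
  (expR (- \sum_(p in J) a p * t p))%:E.
Proof.
move=> indX expX t0; transitivity (P (\bigcap_(p in [set` J]) (X p @^-1` `]t p, +oo[))).
  congr (P _); apply/seteqP; split=> w h p pJ; first by rewrite /= in_itv/= andbT h.
  by have := h p pJ; rewrite /= in_itv/= andbT.
rewrite indX//.
rewrite -sumrN expR_sum (big_morph EFin EFinM erefl); apply: eq_bigr => p pJ.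
rewrite -mulNr -expX//; congr (P _); apply/seteqP.
by split=> w /=; rewrite in_itv/= andbT.
Qed.

End joint_tails.

Theorem theorem3p1 (R : realType) (d : measure_display) (T : measurableType d)
    (P : probability T R) (m n k : nat) (k_gt0 : (1 <= k)%N)
    (k_le : (k <= minn m n)%N)
    (M : 'M[{RV P >-> R}]_(m, n)) (a : 'M[R]_(m, n)) (Z : {set 'I_m * 'I_n})
    (M_zero : forall i j, (i, j) \in Z -> forall w, M i j w = 0)
    (a_gt0 : forall i j, (i, j) \notin Z -> 0 < a i j)
    (M_exp : forall i j, (i, j) \notin Z ->
       exponential_with_rate (a i j) (M i j))
    (M_indep : mutually_independent (~: Z) (fun p => M p.1 p.2))
    (Z_indep : exists2 A : {set 'I_m * 'I_n}, A \subset Z & is_assignment k.-1 A) :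
  let E := 'E_P[fun w => min_assignment k (outcome M w)]%E in
  let f := rate_incidence k a Z in
  (exists g : incidence R (critical k Z),
     [/\ f * g = 1, g * f = 1 &
         E = (\sum_(x : critical k Z) \sum_(y : critical k Z | (x <= y)%O)
                incidence_val g x y)%:E]) /\
  E = (chain_sum k a Z)%:E.
Proof.
move=> E f; have [A0 A0Z A0k] := Z_indep.
have a_pos p : p \notin Z -> 0 < a p.1 p.2.
  by case: p => i j; exact: a_gt0.
have rate_neq0 (x : critical k Z) : rate_of a (rect x) != 0.
  have /andP[xC /eqP xs] := cover_ofP x.
  have [p px] := rectangle_neq0 k_gt0 k_le xs.
  rewrite gt_eqF// (race_rate_gt0 (Z := Z) a_pos _ px)// => q.
  exact: rectangle_disjoint.
pose X (p : 'I_m * 'I_n) (w : T) : R := M p.1 p.2 w.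
have mX p : measurable_fun setT (X p) by exact: measurable_funPT.
(* The law makes the random entries positive only almost surely, while [exponential_on] asks for
   positivity at every point of its event. *)
pose D : set T := [set w | forall p, p \notin Z -> 0 < X p w]%classic.
have mD : measurable D.
  by apply: measurable_forall_fin => p _; apply: measurable_gt_fun => //; exact: measurable_cst.
have tail (t : 'I_m * 'I_n -> R) : (forall p, 0 <= t p) ->
    P [set w | forall p, p \notin Z -> t p < X p w]%classic =
    (expR (- \sum_(p in ~: Z) a p.1 p.2 * t p))%:E.
  move=> t0; rewrite -(independent_exponential_tail M_indep _ t0).
    congr (P _); apply/seteqP; split=> w h p; first by rewrite inE; exact: h.
    by move=> pZ; apply: h; rewrite inE.
  by move=> [i j]; rewrite inE; exact: M_exp.
have XE : exponential_on P D 1 Z (fun p => a p.1 p.2) X.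
  split=> //; first by move=> w _ [i j] ijZ; exact: M_zero.
  move=> t t0; rewrite mul1r -tail//; congr (P _); apply/seteqP.
  split=> [w []//|w h]; split=> // p pZ; exact: le_lt_trans (t0 p) (h p pZ).
have [v vO vE] := integral_min_assignment k_gt0 k_le A0k (ltnSn _) A0Z a_pos ler01 XE.
have mmin := measurable_min_assignment k_le mX.
have EE : E = (\sum_(x : critical k Z) v (cover_of x))%:E.
  transitivity (\int[P]_(w in D) (min_assignment k (matrix_at X w))%:E)%E; last first.
    rewrite vE mul1r (sum_critical k Z xpredT); congr EFin; apply: eq_bigl => y.
    by rewrite andbT.
  rewrite /E unlock [RHS]integral_mkcond; apply: ae_eq_integral => //.
  - apply/measurable_EFinP; apply: eq_measurable_fun mmin => w _.
    by congr min_assignment; apply/matrixP => i j; rewrite !mxE.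
  - apply/(measurable_restrictT _ mD)/measurable_funTS.
    exact/measurable_EFinP.
  (* The complement of [D] is null, since [expon_mass] gives [D] the mass 1. *)
  exists (~` D)%classic; split; first exact: measurableC.
    have := probability_setC P mD; rewrite (expon_mass XE) subee// => ->//.
  move=> w /= h Dw; apply: h => _; rewrite patchE mem_set//; congr EFin.
  by congr min_assignment; apply/matrixP => i j; rewrite !mxE.
(* The occupation condition [vO] is the equation [v f = (1, ..., 1)] on bare covers. *)
have chainE : chain_sum k a Z = \sum_(x : critical k Z) v (cover_of x).
  apply: chain_sum_dual => // z; rewrite -(vO _ (cover_ofP z)).
  exact: (sum_critical k Z (fun y => cover_le y (cover_of z))
    (fun y => v y * rate_of a (rectangle y :&: rectangle (cover_of z)))).
rewrite EE -chainE; split=> //.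
have [|g [fg gf]] := @incidence_invertible _ _ _ f.
  by move=> x; rewrite mk_incidenceE lexx finset.setIid.
by exists g; split=> //; rewrite (chain_sum_inverse _ gf).
Qed.
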